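(* Assume that $X_1$ is of Pareto-type with index $\alpha=2$, i.e. $1-F(x)\sim x^{-2}\ell(x)$ as $x\to\infty$ with $\ell$ slowly varying, and that $\mu_2=\infty$. Let the counting process $\{N(t);\,t\geq 0\}$ $\mathcal{D}$-average in time to the random variable $\Lambda$. Let $(a^\prime_t)_{t>0}$ be defined by $\lim_{t\to\infty}t\,(a^{\prime}_t)^{-2}\tilde\ell(a^\prime_t)=1$, where $\tilde\ell(x)=\int_0^x\frac{\ell(u)}{u}\,du\in\mathrm{RV}_0$. (a) Then $$\left(\frac{N(t)}{a^\prime_t}\right)^2T_{N(t)}\stackrel{\mathcal{D}}{\longrightarrow}\frac{2}{\mu_1^2}\,\Lambda\quad\text{as } t\rightarrow\infty.$$ (b) Then $$\left(\frac{t}{a^\prime_t}\right)^2T_{N(t)}\stackrel{\mathcal{D}}{\longrightarrow}\frac{2}{\mu_1^2}\,\frac{1}{\Lambda}\quad\text{as } t\rightarrow\infty.$$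
   Context: $\{X_1,X_2,\ldots\}$ is a sequence of i.i.d. positive random variables with distribution function $F$, and $\{N(t);\,t\geq 0\}$ is a counting process (nonnegative integer-valued, nondecreasing in $t$) independent of the $X_i$'s. For fixed $t\ge 0$, $$T_{N(t)}:=\frac{X_1^2+\cdots+X_{N(t)}^2}{(X_1+\cdots+X_{N(t)})^2}$$ if $N(t)\geq 1$, and $T_{N(t)}:=0$ otherwise. $\mu_\beta:=\mathbb{E}X_1^\beta\le\infty$ for $\beta>0$. $X_1$ (or $F$) is of Pareto-type with index $\alpha>0$ if $1-F(x)\sim x^{-\alpha}\ell(x)$ as $x\to\infty$ for a slowly varying function $\ell$. $\mathrm{RV}_0$ denotes the class of slowly varying functions. The counting process $\mathcal{D}$-averages in time to the random variable $\Lambda$ if $N(t)/t\stackrel{\mathcal{D}}{\longrightarrow}\Lambda$ as $t\to\infty$, where $\mathbb{P}[\Lambda>0]=1$. $\stackrel{\mathcal{D}}{\longrightarrow}$ denotes convergence in distribution.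
   Formalization: The normalizing family a'_t is additionally assumed to tend to infinity as t→∞; the defining limit relation alone also admits bounded families when ℓ is small near 0, and for those the claim fails. *)

(* Defs.v *)
From HB Require Import structures.
From mathcomp Require Import all_boot all_order all_algebra finmap.
From mathcomp Require Import all_classical all_reals all_analysis.
Set Implicit Arguments.
Unset Strict Implicit.
Unset Printing Implicit Defensive.
Import Order.TTheory GRing.Theory Num.Theory.
Import numFieldNormedType.Exports.
Local Open Scope classical_set_scope.
Local Open Scope ring_scope.

Section RegularVariation.
Context {R : realType}.

Definition slowly_varying (l : R -> R) : Prop :=
  [/\ measurable_fun (`]0, +oo[ : set R) l,
      \forall x \near +oo, 0 < l x &
      forall c : R, 0 < c -> l (c * x) / l x @[x --> +oo] --> (1 : R)].

Definition pareto_type (alpha : R) (F l : R -> R) : Prop :=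
  [/\ 0 < alpha, slowly_varying l &
      (1 - F x) / (x `^ (- alpha) * l x) @[x --> +oo] --> (1 : R)].

(* Kept extended-real valued: [l] is only controlled near +oo, so [l u / u]
   need not be integrable at 0; the requirement put on [a] in
   [normalizing] forces these integrals to be finite. *)
Definition log_integral (l : R -> R) (x : R) : \bar R :=
  (\int[lebesgue_measure]_(u in `]0%R, x]) (l u / u)%:E)%E.

(* The limit relation alone also admits functions [a] with a finite limit when
   [l] is small near 0; the divergence of [a] excludes them. *)
Definition normalizing (l a : R -> R) : Prop :=
  a t @[t --> +oo] --> +oo /\
  ((t * (a t) ^- 2)%:E * log_integral l (a t) @[t --> +oo%R] --> 1)%E.

End RegularVariation.

Section Independence.
Context {d : measure_display} {T : measurableType d} {R : realType}.
Variable P : probability T R.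

Definition mutually_independent d' (T' : measurableType d') (I : choiceType)
    (Y : I -> {RV P >-> T'}) : Prop :=
  forall (J : {fset I}) (A : I -> set T'), (forall i, measurable (A i)) ->
    P (\bigcap_(i in [set` J]) (Y i @^-1` A i)) =
    (\prod_(i <- J) P (Y i @^-1` A i))%E.

Definition identically_distributed d' (T' : measurableType d') (I : Type)
    (Y : I -> {RV P >-> T'}) : Prop :=
  forall i j (A : set T'), measurable A ->
    distribution P (Y i) A = distribution P (Y j) A.

Definition sigma_family d' (T' : measurableType d') (I : Type) (D : set I)
    (Y : I -> {RV P >-> T'}) : set_system T :=
  <<s \bigcup_(i in D) preimage_set_system setT (Y i) measurable >>.

Definition independent_systems (G H : set_system T) : Prop :=
  forall A B, G A -> H B -> (P (A `&` B) = P A * P B)%E.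

End Independence.

Section ConvergenceInLaw.
Context {d d' : measure_display} {T : measurableType d} {T' : measurableType d'}
  {R : realType}.

(* As t -> +oo; the limit [Z] may live on another probability space. *)
Definition cvg_in_distribution (P : probability T R) (Y : R -> T -> R)
    (P' : probability T' R) (Z : T' -> R) : Prop :=
  let G := fun x : R => P' [set w | Z w <= x] in
  [/\ forall t, measurable_fun setT (Y t),
      measurable_fun setT Z &
      forall x : R, {for x, continuous G} ->
        P [set w | Y t w <= x] @[t --> +oo] --> G x].

End ConvergenceInLaw.

Section Model.
Context {d : measure_display} {T : measurableType d} {R : realType}.
Variable P : probability T R.

(* Time is t >= 0; the values of [N] at negative times are never used. *)
Definition counting_process (N : R -> {RV P >-> nat}) : Prop :=
  forall (w : T) (s t : R), 0 <= s -> s <= t -> (N s w <= N t w)%N.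

Definition D_averages d' (T' : measurableType d') (N : R -> {RV P >-> nat})
    (P' : probability T' R) (L : {RV P' >-> R}) : Prop :=
  P' [set w | 0 < L w] = 1%E /\
  cvg_in_distribution P (fun t w => (N t w)%:R / t) P' L.

Definition moment (Y : {RV P >-> R}) (beta : R) : \bar R :=
  'E_P[fun w => Y w `^ beta].

(* [X i] is the (i+1)-st variable of the sequence. *)
Definition T_ (X : nat -> {RV P >-> R}) (n : nat) (w : T) : R :=
  if (0 < n)%N then (\sum_(i < n) X i w ^+ 2) / (\sum_(i < n) X i w) ^+ 2
  else 0.

End Model.

(* Main.v *)
(** The tail [p u = P (X > u)] satisfies [p (2 x) / p x --> 1 / 4], so
[W x = E (min X x)^2] gains about [3/4 x^2 p x] over every dyadic scale and
[x^2 p x = o(W x)]. This makes [mu1] finite and gives [E (min X x)^4 =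
o(x^2 W x)]. By the layer cake formula [W x = \int_0^x 2 u p u du], and since
[u^2 p u ~ l u] and [W --> +oo], [W ~ 2 \int_0^x l u / u du]; hence
[t a_t^-2 W (a_t) --> 2]. Truncating at [t] (resp. at [a_t]) and applying
Chebyshev's inequality, uniformly in [k <= M t],
[(X_1 + ... + X_k) / t = mu1 k / t + o_P(1)] and
[(X_1^2 + ... + X_k^2) / a_t^2 = 2 k / t + o_P(1)].
By independence [k] may be replaced by [N t], so that with [A = N t / t] the
two normalized statistics are within [o_P(1)] of [2 A / mu1^2] and
[2 / (mu1^2 A)]. *)
Require Import Defs.
From HB Require Import structures.
From mathcomp Require Import all_boot all_order all_algebra finmap.
From mathcomp Require Import all_classical all_reals all_analysis.
From mathcomp Require Import measurable_realfun ring lra.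
Set Implicit Arguments.
Unset Strict Implicit.
Unset Printing Implicit Defensive.
Import Order.TTheory GRing.Theory Num.Theory.
Import numFieldNormedType.Exports.
Local Open Scope classical_set_scope.
Local Open Scope ring_scope.

(** * Bounded random variables *)

Section RealProbability.
Context {d : measure_display} {T : measurableType d} {R : realType}.
Variable P : probability T R.

(** The variance of the variables and the mean of their squares are infinite, so Chebyshev's
    inequality is available only after truncation, and the truncation level must serve two ends: [t]
    times the tail at the level tends to 0, so that with high probability none of the at most [M t]
    terms is altered, and the truncated variance is small against the squared norming. Level [t]
    does both for the sums, since [x p x --> 0] and [W x = o(x)]; level [a_t] does both for the sums
    of squares. Slow variation is used at the ratio 2 only: dyadic recursions take the place of
    Karamata's theorem. Each weak law is a bound for every single [k], with a threshold for [t] that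
    does not depend on [k]; conditioning on [N t] then needs no maximal inequality. With [s1], [s2]
    the normalized sums, statistic (a) is [A^2 s2 / s1^2], which is not uniformly continuous for [A]
    near 0 or infinity. Tightness of [A], and the positivity of the limit, confine [A] to an
    interval []r, M]] up to a small probability. *)

Definition prob (A : set T) : R := fine (P A).

Lemma probK A : measurable A -> (prob A)%:E = P A.
Proof. by move=> mA; rewrite /prob fineK// fin_num_measure. Qed.

Lemma prob_ge0 A : 0 <= prob A.
Proof. exact: fine_ge0. Qed.

Lemma prob0 : prob set0 = 0.
Proof. by rewrite /prob measure0. Qed.

Lemma le_prob A B : measurable A -> measurable B -> A `<=` B -> prob A <= prob B.
Proof.
by move=> mA mB AB; rewrite -lee_fin !probK//; apply: le_measure; rewrite ?inE.
Qed.

Lemma prob_le1 A : measurable A -> prob A <= 1.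
Proof. by move=> mA; rewrite -lee_fin probK//; exact: probability_le1. Qed.

Lemma probU A B : measurable A -> measurable B ->
  prob (A `|` B) <= prob A + prob B.
Proof.
move=> mA mB; rewrite -lee_fin EFinD !probK//; last exact: measurableU.
by apply: measureU2.
Qed.

Lemma le_probU C A B : measurable A -> measurable B -> measurable C ->
  C `<=` A `|` B -> prob C <= prob A + prob B.
Proof.
move=> mA mB mC CAB; apply: le_trans (probU mA mB).
by apply: le_prob => //; exact: measurableU.
Qed.

Lemma probC A : measurable A -> prob (~` A) = 1 - prob A.
Proof.
move=> mA; apply: EFin_inj; rewrite EFinB !probK//; last exact: measurableC.
exact: probability_setC.
Qed.

(** Boundedness stands in for integrability: it is stable under products, and it holds for the
    truncated variables and indicators to which [Ex] is applied. *)
Definition bounded_rv (f : T -> R) :=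
  measurable_fun setT f /\ exists M : R, forall w, `|f w| <= M.

Definition Ex (f : T -> R) : R := \int[P]_w f w.

Lemma bounded_rv_integrable f : bounded_rv f -> P.-integrable setT (EFin \o f).
Proof.
move=> [mf [M fM]]; apply: measurable_bounded_integrable => //.
  by rewrite -ge0_fin_numE// fin_num_measure.
exists M; split; first exact: num_real.
by move=> x Mx w _; exact: le_trans (fM w) (ltW Mx).
Qed.

Lemma bounded_rv_cst r : bounded_rv (fun=> r).
Proof. by split; [exact: measurable_cst|exists `|r|]. Qed.

Lemma bounded_rvD f g : bounded_rv f -> bounded_rv g ->
  bounded_rv (fun w => f w + g w).
Proof.
move=> [mf [M fM]] [mg [M' gM]]; split; first exact: measurable_funD.
by exists (M + M') => w; apply: le_trans (ler_normD _ _) _; apply: lerD.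
Qed.

Lemma bounded_rvM f g : bounded_rv f -> bounded_rv g ->
  bounded_rv (fun w => f w * g w).
Proof.
move=> [mf [M fM]] [mg [M' gM]]; split; first exact: measurable_funM.
by exists (M * M') => w; rewrite normrM; apply: ler_pM.
Qed.

Lemma bounded_rvB f g : bounded_rv f -> bounded_rv g ->
  bounded_rv (fun w => f w - g w).
Proof.
move=> [mf [M fM]] [mg [M' gM]]; split; first exact: measurable_funB.
by exists (M + M') => w; apply: le_trans (ler_normB _ _) _; apply: lerD.
Qed.

Lemma bounded_rvX f n : bounded_rv f -> bounded_rv (fun w => f w ^+ n).
Proof.
move=> bf; elim: n => [|n ih]; first exact: bounded_rv_cst.
under eq_fun do rewrite exprS.
exact: bounded_rvM.
Qed.

Lemma bounded_rv_sum (I : Type) (s : seq I) (f : I -> T -> R) :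
  (forall i, bounded_rv (f i)) -> bounded_rv (fun w => \sum_(i <- s) f i w).
Proof.
move=> bf; elim: s => [|i s ih].
  under eq_fun do rewrite big_nil.
  exact: bounded_rv_cst.
under eq_fun do rewrite big_cons.
exact: bounded_rvD.
Qed.

Lemma bounded_rv_indic A : measurable A -> bounded_rv \1_A.
Proof.
move=> mA; split; first exact: measurable_indic.
by exists 1 => w; rewrite indicE; case: (_ \in _); rewrite ?normr0 ?normr1.
Qed.

Lemma Ex_cst r : Ex (fun=> r) = r.
Proof.
rewrite /Ex Rintegral_cst// [X in fine X](_ : _ = 1%E) ?mulr1//.
exact: probability_setT.
Qed.

Lemma ExD f g : bounded_rv f -> bounded_rv g ->
  Ex (fun w => f w + g w) = Ex f + Ex g.
Proof. by move=> bf bg; apply: RintegralD => //; exact: bounded_rv_integrable. Qed.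

Lemma ExB f g : bounded_rv f -> bounded_rv g ->
  Ex (fun w => f w - g w) = Ex f - Ex g.
Proof. by move=> bf bg; apply: RintegralB => //; exact: bounded_rv_integrable. Qed.

Lemma ExZ r f : bounded_rv f -> Ex (fun w => r * f w) = r * Ex f.
Proof. by move=> bf; apply: RintegralZl => //; exact: bounded_rv_integrable. Qed.

Lemma le_Ex f g : bounded_rv f -> bounded_rv g -> (forall w, f w <= g w) ->
  Ex f <= Ex g.
Proof.
by move=> bf bg fg; apply: le_Rintegral => //; exact: bounded_rv_integrable.
Qed.

Lemma Ex_ge0 f : (forall w, 0 <= f w) -> 0 <= Ex f.
Proof. by move=> f0; apply: Rintegral_ge0. Qed.

Lemma Ex_sum (I : Type) (s : seq I) (f : I -> T -> R) :
  (forall i, bounded_rv (f i)) ->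
  Ex (fun w => \sum_(i <- s) f i w) = \sum_(i <- s) Ex (f i).
Proof.
move=> bf; elim: s => [|i s ih].
  under eq_fun do rewrite big_nil.
  by rewrite Ex_cst big_nil.
under eq_fun do rewrite big_cons.
by rewrite ExD ?big_cons ?ih//; exact: bounded_rv_sum.
Qed.

Lemma Ex_indic A : measurable A -> Ex \1_A = prob A.
Proof. by move=> mA; rewrite /Ex /Rintegral integral_indic// setIT. Qed.

Lemma EFin_Ex f : bounded_rv f -> (Ex f)%:E = (\int[P]_w (f w)%:E)%E.
Proof.
move=> bf; rewrite /Ex /Rintegral fineK//; apply: integrable_fin_num => //.
exact: bounded_rv_integrable.
Qed.

Lemma measurable_ler (f : T -> R) (c : R) : measurable_fun setT f ->
  measurable [set w : T | c <= f w].
Proof.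
move=> mf; rewrite -[X in measurable X]setTI.
have -> : [set w | c <= f w] = f @^-1` `[c, +oo[.
  by apply/seteqP; split => w /=; rewrite in_itv/= andbT.
by apply: mf.
Qed.

Lemma measurable_gtr (f : T -> R) (c : R) : measurable_fun setT f ->
  measurable [set w : T | c < f w].
Proof.
move=> mf; rewrite -[X in measurable X]setTI.
have -> : [set w | c < f w] = f @^-1` `]c, +oo[.
  by apply/seteqP; split => w /=; rewrite in_itv/= andbT.
by apply: mf.
Qed.

Lemma measurable_ger (f : T -> R) (c : R) : measurable_fun setT f ->
  measurable [set w : T | f w <= c].
Proof.
move=> mf; rewrite -[X in measurable X]setTI.
have -> : [set w | f w <= c] = f @^-1` `]-oo, c].
  by apply/seteqP; split => w /=; rewrite in_itv/=.
by apply: mf.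
Qed.

Lemma prob_gt (f : T -> R) (c : R) : measurable_fun setT f ->
  prob [set w | c < f w] = 1 - prob [set w | f w <= c].
Proof.
move=> mf; rewrite -probC; last exact: measurable_ger.
by congr (prob _); apply/seteqP; split => w /=; rewrite ltNge => /negP.
Qed.

Lemma markov_sqr f (e : R) : 0 < e -> bounded_rv f ->
  prob [set w | e <= `|f w|] <= Ex (fun w => f w ^+ 2) / e ^+ 2.
Proof.
move=> e0 bf; have mA : measurable [set w | e <= `|f w|].
  by apply: measurable_ler; apply: measurableT_comp => //; case: bf.
rewrite ler_pdivlMr ?exprn_gt0// mulrC -Ex_indic// -ExZ; last first.
  exact: bounded_rv_indic.
apply: le_Ex => [||w].
- apply: bounded_rvM; [exact: bounded_rv_cst|exact: bounded_rv_indic].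
- exact: bounded_rvX.
- rewrite indicE; have [|_] := boolP (_ \in _); last by rewrite mulr0 sqr_ge0.
  rewrite inE/= => ef; rewrite mulr1 -(real_normK (num_real (f w))).
  by rewrite ler_sqr ?nnegrE// ltW.
Qed.

End RealProbability.

(** * Weak law for bounded functions of an independent sequence *)

Section Independence.
Context {d : measure_display} {T : measurableType d} {R : realType}.
Variable P : probability T R.
Local Notation prob := (prob P).
Local Notation Ex := (Ex P).

Lemma Ex_comp (Y : {RV P >-> R}) (h : R -> R) :
  measurable_fun setT h -> (forall x, 0 <= h x) ->
  (\int[P]_w (h (Y w))%:E = \int[distribution P Y]_x (h x)%:E)%E.
Proof.
move=> mh h0; rewrite (ge0_integral_distribution Y (f := EFin \o h))//.
exact/measurable_EFinP.
Qed.

Lemma Ex_eq_distribution (Y Z : {RV P >-> R}) (h : R -> R) :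
  (forall A : set R, measurable A -> distribution P Y A = distribution P Z A) ->
  measurable_fun setT h -> (forall x, 0 <= h x) ->
  Ex (fun w => h (Y w)) = Ex (fun w => h (Z w)).
Proof.
move=> YZ mh h0; rewrite /Ex /Rintegral !Ex_comp//; congr fine.
by apply: eq_measure_integral => A mA _; exact: YZ.
Qed.

(** The law of the pair agrees with the product of the marginal laws on rectangles, hence everywhere
    by uniqueness of the product measure; Tonelli's theorem then factors the integral. *)
Lemma ExM_indep (Y Z : {RV P >-> R}) (h g : R -> R) (M : R) :
  (forall A B : set R, measurable A -> measurable B ->
    P (Y @^-1` A `&` Z @^-1` B) = (P (Y @^-1` A) * P (Z @^-1` B))%E) ->
  measurable_fun setT h -> measurable_fun setT g ->
  (forall x, 0 <= h x <= M) -> (forall x, 0 <= g x <= M) ->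
  Ex (fun w => h (Y w) * g (Z w)) = Ex (fun w => h (Y w)) * Ex (fun w => g (Z w)).
Proof.
move=> YZ mh mg hM gM.
have h0 x : 0 <= h x by case/andP: (hM x).
have g0 x : 0 <= g x by case/andP: (gM x).
have bh : bounded_rv (fun w => h (Y w)).
  split; first exact: measurableT_comp.
  by exists M => w; rewrite ger0_norm//; case/andP: (hM (Y w)).
have bg : bounded_rv (fun w => g (Z w)).
  split; first exact: measurableT_comp.
  by exists M => w; rewrite ger0_norm//; case/andP: (gM (Z w)).
apply: EFin_inj; rewrite EFinM !EFin_Ex//; last exact: bounded_rvM.
pose V w := (Y w, Z w).
have mV : measurable_fun setT V by exact: measurable_fun_pair.
pose Vm : {mfun T >-> (R * R)%type} := HB.pack V (isMeasurableFun.Build _ _ _ _ V mV).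
pose f (p : R * R) := (h p.1 * g p.2)%:E.
have mf : measurable_fun setT f.
  apply/measurable_EFinP; apply: measurable_funM.
    exact: (measurableT_comp mh).
  exact: (measurableT_comp mg).
have f0 p : (0 <= f p)%E by rewrite lee_fin mulr_ge0.
transitivity (\int[distribution P Vm]_p f p)%E.
  by rewrite ge0_integral_distribution.
transitivity (\int[(distribution P Y \x distribution P Z)%E]_p f p)%E.
  apply: eq_measure_integral => A mA _; apply/esym.
  exact: product_measure_unique.
rewrite fubini_tonelli1//= /fubini_F/=.
transitivity (\int[distribution P Y]_x ((\int[distribution P Z]_y (g y)%:E) * (h x)%:E))%E.
  apply: eq_integral => x _; rewrite muleC -ge0_integralZl//.
  - exact/measurable_EFinP.
  - by move=> y _; rewrite lee_fin.
  - by rewrite lee_fin.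
rewrite ge0_integralZl//.
- by rewrite muleC -!Ex_comp.
- exact/measurable_EFinP.
- by move=> y _; rewrite lee_fin.
- by apply: integral_ge0 => y _; rewrite lee_fin.
Qed.

Lemma mutually_independent_pair (X : nat -> {RV P >-> R}) i j :
  mutually_independent X -> i != j ->
  forall A B : set R, measurable A -> measurable B ->
    P (X i @^-1` A `&` X j @^-1` B) = (P (X i @^-1` A) * P (X j @^-1` B))%E.
Proof.
move=> Xind ij A B mA mB.
(* The family must be defined at every index; only its values at [i] and [j] count. *)
have := Xind [fset i; j]%fset (fun k => if k == i then A else B).
rewrite big_fsetU1/= ?inE// big_seq_fset1 eqxx eq_sym (negbTE ij) => <-.
  congr (P _); apply/seteqP; split => w /=.
    move=> [wA wB] k /=; rewrite !inE => /orP[]/eqP ->; first by rewrite eqxx.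
    by rewrite eq_sym (negbTE ij).
  move=> h; split; first by have := h i; rewrite /= !inE eqxx; apply.
  by have := h j; rewrite /= !inE eqxx orbT (eq_sym j) (negbTE ij); apply.
by move=> k; case: ifP.
Qed.

(** The cross terms of the centred square vanish by pairwise independence, and each variance is at
    most the second moment. *)
Lemma variance_sum_le (X : nat -> {RV P >-> R}) (h : R -> R) (M : R) k :
  mutually_independent X -> identically_distributed X ->
  measurable_fun setT h -> (forall x, 0 <= h x <= M) ->
  Ex (fun w => (\sum_(i < k) h (X i w) - k%:R * Ex (fun w => h (X 0%N w))) ^+ 2)
    <= k%:R * Ex (fun w => h (X 0%N w) ^+ 2).
Proof.
move=> Xind Xid mh hM.
have h0 x : 0 <= h x by case/andP: (hM x).
set e := Ex (fun w => h (X 0%N w)).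
have bh i : bounded_rv (fun w => h (X i w)).
  split; first exact: measurableT_comp.
  by exists M => w; rewrite ger0_norm//; case/andP: (hM (X i w)).
pose Y i w := h (X i w) - e.
have bY i : bounded_rv (Y i) by apply: bounded_rvB => //; exact: bounded_rv_cst.
have Ee i : Ex (fun w => h (X i w)) = e.
  by apply: Ex_eq_distribution => // A mA; exact: Xid.
have EY i : Ex (Y i) = 0.
  by rewrite ExB// ?Ee ?Ex_cst ?subrr//; exact: bounded_rv_cst.
have EYY i j : i != j -> Ex (fun w => Y i w * Y j w) = 0.
  move=> ij; have bhe l : bounded_rv (fun w => h (X l w) - e) by exact: bY.
  rewrite /Y.
  under eq_fun => w do rewrite mulrBr.
  rewrite ExB; last 2 first.
  - exact: bounded_rvM.
  - by apply: bounded_rvM => //; exact: bounded_rv_cst.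
  under eq_fun => w do rewrite mulrBl.
  rewrite ExB; last 2 first.
  - exact: bounded_rvM.
  - by apply: bounded_rvM => //; exact: bounded_rv_cst.
  under [X in _ - Ex X]eq_fun => w do rewrite mulrC.
  rewrite !ExZ// EY mulr0 subr0.
  by rewrite (ExM_indep (mutually_independent_pair Xind ij) mh mh hM hM) !Ee subrr.
have EY2 i : Ex (fun w => Y i w ^+ 2) <= Ex (fun w => h (X 0%N w) ^+ 2).
  have -> : Ex (fun w => h (X 0%N w) ^+ 2) = Ex (fun w => h (X i w) ^+ 2).
    apply: (@Ex_eq_distribution _ _ (fun x => h x ^+ 2)) => [A mA||x].
    - exact: Xid.
    - exact: measurable_funX.
    - exact: sqr_ge0.
  (* Written this way because [Y i] is centred: its mean square is the second moment minus
     [e ^+ 2]. *)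
  have -> : (fun w => Y i w ^+ 2) =
            (fun w => h (X i w) ^+ 2 - (e *+ 2 * Y i w + e ^+ 2)).
    by apply/funext => w; rewrite /Y; ring.
  have b1 : bounded_rv (fun w => e *+ 2 * Y i w).
    by apply: bounded_rvM => //; exact: bounded_rv_cst.
  have b2 : bounded_rv (fun=> e ^+ 2 : R) := bounded_rv_cst _.
  rewrite ExB; [|exact: bounded_rvX|exact: bounded_rvD].
  by rewrite lerBlDr lerDl ExD// ExZ// EY mulr0 add0r Ex_cst sqr_ge0.
have -> : (fun w => (\sum_(i < k) h (X i w) - k%:R * e) ^+ 2) =
          (fun w => (\sum_(i < k) Y i w) ^+ 2).
  by apply/funext => w; rewrite sumrB sumr_const card_ord mulr_natl.
elim: k => [|k ih].
  by under eq_fun do rewrite big_ord0 expr0n/=; rewrite Ex_cst mul0r.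
have bS : bounded_rv (fun w => \sum_(i < k) Y i w) by exact: bounded_rv_sum.
under eq_fun => w do rewrite big_ord_recr/= sqrrD.
rewrite ExD; last 2 first.
- apply: bounded_rvD; first exact: bounded_rvX.
  under eq_fun => w do rewrite -mulr_natr.
  apply: bounded_rvM; last exact: bounded_rv_cst.
  exact: bounded_rvM.
- exact: bounded_rvX.
rewrite ExD; last 2 first.
- exact: bounded_rvX.
- under eq_fun => w do rewrite -mulr_natr.
  apply: bounded_rvM; last exact: bounded_rv_cst.
  exact: bounded_rvM.
under [X in _ + Ex X + _]eq_fun => w do rewrite -mulr_natl mulr_suml.
rewrite ExZ; last by apply: bounded_rv_sum => i; exact: bounded_rvM.
rewrite Ex_sum; last by move=> i; exact: bounded_rvM.
rewrite big1 ?mulr0 ?addr0; last first.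
  by move=> i _; apply: EYY; rewrite neq_ltn ltn_ord.
by rewrite -natr1 mulrDl mul1r lerD.
Qed.

Lemma weak_law_bounded (X : nat -> {RV P >-> R}) (h : R -> R) (M : R) k (e : R) :
  mutually_independent X -> identically_distributed X ->
  measurable_fun setT h -> (forall x, 0 <= h x <= M) -> 0 < e ->
  prob [set w | e <=
      `|\sum_(i < k) h (X i w) - k%:R * Ex (fun w => h (X 0%N w))|]
    <= k%:R * Ex (fun w => h (X 0%N w) ^+ 2) / e ^+ 2.
Proof.
move=> Xind Xid mh hM e0.
apply: (@le_trans _ _ (Ex (fun w => (\sum_(i < k) h (X i w) -
    k%:R * Ex (fun w => h (X 0%N w))) ^+ 2) / e ^+ 2)).
  apply: markov_sqr => //; apply: bounded_rvB; last exact: bounded_rv_cst.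
  apply: bounded_rv_sum => i; split; first exact: measurableT_comp.
  by exists M => w; case/andP: (hM (X i w)) => h0 ?; rewrite ger0_norm.
by rewrite ler_pM2r ?invr_gt0 ?exprn_gt0//; exact: variance_sum_le hM.
Qed.

End Independence.

(** * Truncated moments and tails *)

Section NearInfinity.
Context {R : realType}.
Implicit Types (S : set R) (f g : R -> R).

Lemma near_pinfty_scale (c : R) S : 0 < c ->
  (\forall x \near +oo, S x) -> \forall x \near +oo, S (c * x).
Proof.
move=> c0 [M [_ SM]]; exists (M / c); split; first exact: num_real.
by move=> x Mx; apply: SM; rewrite -ltr_pdivrMl// mulrC.
Qed.

Lemma near_pinfty_gt (c : R) : \forall x \near +oo, c < x.
Proof. by exists c; split; first exact: num_real. Qed.

Lemma near_pinftyI (S1 S2 : set R) : (\forall x \near +oo, S1 x) ->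
  (\forall x \near +oo, S2 x) -> \forall x \near +oo, S1 x /\ S2 x.
Proof. by move=> h1 h2; near=> x; split; near: x. Unshelve. all: by end_near. Qed.

End NearInfinity.

Section Truncation.
Context {R : realType}.
Implicit Types (x y c : R).

(** Clipping at 0 as well makes the truncation bounded on the whole line; the variables are positive
    only almost surely. *)
Definition trunc c x := Num.min (Num.max 0 x) c.

Lemma trunc_spec c x : 0 <= c ->
  [\/ x <= 0 /\ trunc c x = 0, [/\ 0 < x, x <= c & trunc c x = x] |
      [/\ 0 < x, c < x & trunc c x = c]].
Proof.
move=> c0; rewrite /trunc; have [x0|x0] := leP x 0.
  by apply: Or31; rewrite min_l.
have [xc|xc] := leP x c; first exact: Or32.
exact: Or33.
Qed.

Lemma trunc_ge0 c x : 0 <= c -> 0 <= trunc c x.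
Proof. by move=> c0; case: (trunc_spec x c0) => [[_ ->]|[? _ ->]|[_ _ ->]]//; lra. Qed.

Lemma trunc_le c x : trunc c x <= c.
Proof. by rewrite /trunc ge_min lexx orbT. Qed.

Lemma le_trunc c c' x : c <= c' -> trunc c x <= trunc c' x.
Proof. by move=> cc'; rewrite /trunc le_min !ge_min lexx cc' orbT. Qed.

Lemma measurable_trunc c : measurable_fun setT (trunc c).
Proof.
apply: measurable_minr; last exact: measurable_cst.
by apply: measurable_maxr; [exact: measurable_cst|exact: measurable_id].
Qed.

Lemma truncX_bound c n x : 0 <= c -> 0 <= trunc c x ^+ n <= c ^+ n.
Proof.
move=> c0; rewrite exprn_ge0 ?trunc_ge0//=.
by apply: lerXn2r; rewrite ?nnegrE ?trunc_ge0 ?trunc_le.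
Qed.

End Truncation.

Section Tail.
Context {d : measure_display} {T : measurableType d} {R : realType}.
Variables (P : probability T R) (Y : {RV P >-> R}).

Definition tail (u : R) : R := prob P [set w | u < Y w].

Definition tmoment (n : nat) (c : R) : R := Ex P (fun w => trunc c (Y w) ^+ n).

Lemma bounded_trunc n c : 0 <= c -> bounded_rv (fun w => trunc c (Y w) ^+ n).
Proof.
move=> c0; split.
  apply: measurable_funX; apply: measurableT_comp; last exact: measurable_funPT.
  exact: measurable_trunc.
exists (c ^+ n) => w; have /andP[h0 h1] := truncX_bound n (Y w) c0.
by rewrite ger0_norm.
Qed.

Lemma measurable_tail u : measurable [set w | u < Y w].
Proof. by apply: measurable_gtr. Qed.

Lemma tail_ge0 u : 0 <= tail u. Proof. exact: prob_ge0. Qed.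

Lemma bounded_tail u : bounded_rv (\1_[set w | u < Y w] : T -> R).
Proof. by apply: bounded_rv_indic; exact: measurable_tail. Qed.

Lemma tmoment_ge0 n c : 0 <= c -> 0 <= tmoment n c.
Proof. by move=> c0; apply: Ex_ge0 => w; rewrite exprn_ge0// trunc_ge0. Qed.

Lemma le_tmoment n c c' : 0 <= c -> c <= c' -> tmoment n c <= tmoment n c'.
Proof.
move=> c0 cc'; have c'0 := le_trans c0 cc'.
apply: le_Ex; [exact: bounded_trunc..|] => w.
by apply: lerXn2r; rewrite ?nnegrE ?trunc_ge0 ?le_trunc.
Qed.

(** Reduces an inequality between truncated moments and a tail to a pointwise one in [y], which is
    then settled by locating [y] among the truncation levels. *)
Lemma le_tmoment_tail n1 n2 (c c1 c2 u a b : R) : 0 <= c1 -> 0 <= c2 ->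
  (forall y, a * trunc c1 y ^+ n1 + (if u < y then b else 0) <=
             c * trunc c2 y ^+ n2) ->
  a * tmoment n1 c1 + b * tail u <= c * tmoment n2 c2.
Proof.
move=> c10 c20 H; rewrite /tail -Ex_indic; last exact: measurable_tail.
have b1 : bounded_rv (fun w => a * trunc c1 (Y w) ^+ n1).
  by apply: bounded_rvM; [exact: bounded_rv_cst|exact: bounded_trunc].
have b2 : bounded_rv (fun w => b * \1_[set w | u < Y w] w).
  by apply: bounded_rvM; [exact: bounded_rv_cst|exact: (bounded_tail u)].
have b3 : bounded_rv (fun w => c * trunc c2 (Y w) ^+ n2).
  by apply: bounded_rvM; [exact: bounded_rv_cst|exact: bounded_trunc].
have t1 := bounded_trunc n1 c10; have t2 := bounded_trunc n2 c20.
have t3 := bounded_tail u.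
rewrite /tmoment -!ExZ//.
rewrite -ExD//; apply: le_Ex => // [|w]; first exact: bounded_rvD.
apply: le_trans (H (Y w)); rewrite lerD2l indicE.
by case: ifPn => uY; [rewrite mem_set ?mulr1|rewrite memNset ?mulr0//= (negbTE uY)].
Qed.

(** Where the variable exceeds [x], its truncated square rises from [x^2 / 4] to [x^2]. *)
Lemma tmoment2_half x : 0 < x ->
  tmoment 2 (x / 2) + 3 / 4 * x ^+ 2 * tail x <= tmoment 2 x.
Proof.
move=> x0; rewrite -[X in X + _]mul1r -[leRHS]mul1r.
apply: le_tmoment_tail; [lra|lra|] => y.
case: (@trunc_spec _ (x / 2) y ltac:(lra)) => [[? ->]|[? ? ->]|[? ? ->]];
case: (@trunc_spec _ x y ltac:(lra)) => [[? ->]|[? ? ->]|[? ? ->]];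
case: ltP => ?; nra.
Qed.

(** Raising the level from [x] to [2 x] adds at most [x], and only where the variable exceeds
    [x]. *)
Lemma tmoment1_double x : 0 < x -> tmoment 1 (2 * x) <= tmoment 1 x + x * tail x.
Proof.
move=> x0; rewrite -lerBlDr -mulNr -[X in X + _]mul1r -[leRHS]mul1r.
apply: le_tmoment_tail; [lra|lra|] => y; rewrite !expr1.
case: (@trunc_spec _ (2 * x) y ltac:(lra)) => [[? ->]|[? ? ->]|[? ? ->]];
case: (@trunc_spec _ x y ltac:(lra)) => [[? ->]|[? ? ->]|[? ? ->]];
case: ltP => ?; lra.
Qed.

Lemma tmoment1_half x : 0 < x ->
  tmoment 1 (x / 2) + x / 2 * tail x <= tmoment 1 x.
Proof.
move=> x0; rewrite -[X in X + _]mul1r -[leRHS]mul1r.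
apply: le_tmoment_tail; [lra|lra|] => y; rewrite !expr1.
case: (@trunc_spec _ (x / 2) y ltac:(lra)) => [[? ->]|[? ? ->]|[? ? ->]];
case: (@trunc_spec _ x y ltac:(lra)) => [[? ->]|[? ? ->]|[? ? ->]];
case: ltP => ?; lra.
Qed.

(** Split at [e * x]: below it, one of the two factors of order [n] is at most [(e * x) ^+ n]; above
    it, both are at most [x ^+ n]. *)
Lemma tmoment_doubling n x e : 0 < x -> 0 < e <= 1 ->
  tmoment (n + n) x <= (e * x) ^+ n * tmoment n x + x ^+ (n + n) * tail (e * x).
Proof.
move=> x0 /andP[e0 e1]; rewrite -lerBlDr -mulNr -[X in X + _]mul1r.
apply: le_tmoment_tail; [lra|lra|] => y; rewrite mul1r exprD.
have tx := trunc_ge0 y (ltW x0); have tx' := trunc_le x y.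
case: ltP => exy.
  apply: (@le_trans _ _ 0); last by rewrite mulr_ge0// exprn_ge0//; nra.
  by rewrite subr_le0 exprD ler_pM ?exprn_ge0// lerXn2r// nnegrE; lra.
rewrite addr0; apply: ler_wpM2r; first by rewrite exprn_ge0.
apply: lerXn2r; rewrite ?nnegrE//; first by nra.
case: (trunc_spec y (ltW x0)) => [[_ ->]|[_ _ ->]//|[_ xy _]]; nra.
Qed.

Lemma tmoment2_le x : 0 <= x -> tmoment 2 x <= x * tmoment 1 x.
Proof.
move=> x0; have b1 := bounded_trunc 1 x0; have b2 := bounded_trunc 2 x0.
rewrite /tmoment -ExZ//; apply: le_Ex => // [|w].
  by apply: bounded_rvM => //; exact: bounded_rv_cst.
by rewrite expr2 expr1 ler_wpM2r ?trunc_ge0 ?trunc_le.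
Qed.

End Tail.

(** * Moment estimates for a tail of regular variation of index -2 *)

Section TailRegularVariation.
Context {d : measure_display} {T : measurableType d} {R : realType}.
Variables (P : probability T R) (Y : {RV P >-> R}).
Hypothesis Ypos : P [set w | 0 < Y w] = 1%E.
Local Notation tail := (tail Y).
Local Notation tmoment := (tmoment Y).

Lemma prob_le0 : prob P [set w | Y w <= 0] = 0.
Proof.
have m0 := measurable_tail Y 0.
have -> : [set w | Y w <= 0] = ~` [set w | 0 < Y w].
  by apply/seteqP; split => w /=; rewrite leNgt => /negP.
by rewrite probC// /prob Ypos subrr.
Qed.

Lemma tmoment_cvg n :
  (tmoment n k%:R)%:E @[k --> \oo] --> moment Y n%:R.
Proof.
(* The real power in [moment] agrees with the integer power of the positive part wherever [Y] is
   positive, hence almost surely. *)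
have -> : moment Y n%:R = (\int[P]_w (Num.max 0 (Y w) ^+ n)%:E)%E.
  rewrite /moment unlock; apply: ge0_ae_eq_integral => //.
  - apply/measurable_EFinP; apply: (measurableT_comp (measurable_powR _)).
    exact: measurable_funPT.
  - apply/measurable_EFinP; apply: measurable_funX; apply: measurable_maxr => //.
  - by move=> w _; rewrite lee_fin powR_ge0.
  - by move=> w _; rewrite lee_fin exprn_ge0// le_max lexx.
  - exists [set w | Y w <= 0]; split => //.
    + by apply: measurable_ger.
    + have mN : measurable [set w | Y w <= 0] by apply: measurable_ger.
      by rewrite -[LHS](probK P mN) prob_le0.
    + move=> w /=; apply: contra_notP => /negP; rewrite -ltNge => Y0 _.
      by rewrite max_r ?powR_mulrn// ltW.
pose g k w := (trunc k%:R (Y w) ^+ n)%:E.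
have -> : (fun k => (tmoment n k%:R)%:E) = (fun k : nat => \int[P]_w g k w)%E.
  by apply/funext => k; rewrite /tmoment EFin_Ex//; exact: bounded_trunc.
have -> : (\int[P]_w (Num.max 0 (Y w) ^+ n)%:E)%E = (\int[P]_w limn (g^~ w))%E.
  apply: eq_integral => w _; apply/esym/cvg_lim => //.
  apply: cvg_near_cst.
  have := nbhs_infty_ger (Y w); apply: filterS => k Yk; congr (_%:E); congr (_ ^+ _).
  by rewrite /trunc min_l// ge_max ler0n.
apply: cvg_monotone_convergence => //.
- move=> k; apply/measurable_EFinP.
  by have [] := bounded_trunc Y n (ler0n R k).
- by move=> k w _; rewrite lee_fin exprn_ge0// trunc_ge0.
- move=> w _ j k jk; rewrite lee_fin lerXn2r ?nnegrE ?trunc_ge0//.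
  by apply: le_trunc; rewrite ler_nat.
Qed.

Lemma tmoment_le_moment n c : 0 <= c -> ((tmoment n c)%:E <= moment Y n%:R)%E.
Proof.
move=> c0; apply: cvge_to_ge (@tmoment_cvg n) _.
have := nbhs_infty_ger c; apply: filterS => k ck.
by rewrite lee_fin le_tmoment.
Qed.

Lemma tmoment_cvgy n : moment Y n%:R = +oo%E ->
  forall A, \forall x \near +oo, A <= tmoment n x.
Proof.
move=> my A; have := @tmoment_cvg n; rewrite my => /cvgeyPge/(_ A)[k _ Ak].
have := @near_pinfty_gt R k%:R; apply: filterS => x kx.
have := Ak k (leqnn k); rewrite /= lee_fin => /le_trans; apply.
by apply: le_tmoment; [exact: ler0n|exact: ltW].
Qed.

(** Monotonicity in the level turns the limit along the integers into one along the reals. *)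
Lemma tmoment_cvg_fin n B : (forall x, 0 < x -> tmoment n x <= B) ->
  (moment Y n%:R \is a fin_num) /\
  forall e, 0 < e -> \forall x \near +oo,
    fine (moment Y n%:R) - e <= tmoment n x <= fine (moment Y n%:R).
Proof.
move=> xB.
have mfin : moment Y n%:R \is a fin_num.
  rewrite ge0_fin_numE; last first.
    by apply: le_trans (tmoment_le_moment n (lexx 0)); rewrite lee_fin tmoment_ge0.
  apply: (@le_lt_trans _ _ B%:E); last exact: ltry.
  apply: cvge_to_le (@tmoment_cvg n) _; exists 1%N => // k /= k1.
  by rewrite lee_fin xB// ltr0n.
split=> // e e0; have := @tmoment_cvg n; rewrite -(fineK mfin).
move=> /fine_cvgP[_ /cvgrPdist_le/(_ _ e0)[k _ ke]].
have := near_pinftyI (@near_pinfty_gt R k%:R) (@near_pinfty_gt R 0).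
apply: filterS => x [kx x0] /=.
have := ke k (leqnn k); rewrite /= ler_norml => /andP[_].
have := @le_tmoment _ _ _ _ Y n k%:R x (ler0n _ _) (ltW kx).
have := tmoment_le_moment n (ltW x0); rewrite -[X in (_ <= X)%E](fineK mfin) lee_fin.
lra.
Qed.

(** The limit [tail (2 x) / tail x --> 1 / 4] as two inequalities without division, so that
    positivity of the tail never has to be tracked. *)
Definition tail_rv2 := forall e : R, 0 < e -> \forall x \near +oo,
  tail x <= (1 + e) * (4 * tail (2 * x)) /\
  4 * tail (2 * x) <= (1 + e) * tail x.

Hypothesis Yrv : tail_rv2.

(** If the bound holds with [K] at [x / 2], then [W x] is at least [K / 8 x^2 tail (x / 2) + 3 / 4
    x^2 tail x], which is about [(K / 2 + 3 / 4) x^2 tail x]. Only [1 / 2] of the gain [3 / 4] is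
    kept; the rest absorbs the error in the ratio of the tails. *)
Lemma tail_negligible (K : nat) :
  \forall x \near +oo, K%:R / 2 * (x ^+ 2 * tail x) <= tmoment 2 x.
Proof.
elim: K => [|K ih].
  have := @near_pinfty_gt R 0; apply: filterS => x x0.
  by rewrite mul0r mul0r tmoment_ge0 ?ltW.
(* Small enough for [(2 K - 1) (1 + e) <= 2 K]. *)
pose e : R := (2 * K%:R + 2)^-1.
have K0 : 0 <= K%:R :> R by rewrite ler0n.
have e0 : 0 < e by rewrite invr_gt0; lra.
have eK : e * (2 * K%:R + 2) = 1 by rewrite mulVf//; apply: lt0r_neq0; lra.
have h0 : (0 : R) < 2^-1 by lra.
have := near_pinftyI (near_pinfty_scale h0 (near_pinftyI ih (Yrv e0))) (@near_pinfty_gt R 0).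
apply: filterS => x [[]].
have -> : 2 * (2^-1 * x) = x by rewrite mulrA divff ?mul1r.
rewrite (mulrC 2^-1) => iH [_ Hx] x0.
have := tmoment2_half Y x0; have := tail_ge0 Y x; rewrite -[K.+1%:R]natr1.
set U := tail x in Hx *; set V := tail (x / 2) in iH Hx *.
set W := tmoment 2 x; set W2 := tmoment 2 (x / 2) in iH *.
move=> U0 HW.
have V0 : 0 <= V by exact: tail_ge0.
have UV : (K%:R + 1) / 2 * U <= K%:R / 8 * V + 3 / 4 * U.
  (* The case [K = 0] is apart because the multiplier [2 K - 1] below must be nonnegative. *)
  case: (posnP K) => [->|Kpos]; first by lra.
  have K1 : 1 <= K%:R :> R by rewrite ler1n.
  have : (2 * K%:R - 1) * (4 * U) <= (2 * K%:R - 1) * ((1 + e) * V).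
    by apply: ler_wpM2l => //; lra.
  have : (2 * K%:R - 1) * (1 + e) * V <= 2 * K%:R * V by apply: ler_wpM2r => //; nra.
  lra.
have : x ^+ 2 * ((K%:R + 1) / 2 * U) <= x ^+ 2 * (K%:R / 8 * V + 3 / 4 * U).
  by apply: ler_wpM2l => //; exact: sqr_ge0.
nra.
Qed.

(** A potential that dominates the truncated mean does not increase under doubling from some level
    on. *)
Lemma tmoment1_bounded : exists B, forall x, 0 < x -> tmoment 1 x <= B.
Proof.
have h : (0 : R) < 2^-1 by lra.
have [M [_ HM]] := Yrv h.
pose x0 := `|M| + 1.
have x0M : M < x0 by rewrite /x0; have := ler_norm M; lra.
have x00 : 0 < x0 by rewrite /x0; have := normr_ge0 M; lra.
(* The factor 4 closes the recursion: doubling [x] adds at most [x * tail x] to the truncated mean,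
   and with ratio error [1 / 2] the new second term is at most [3 * (x * tail x)]. *)
pose g x := tmoment 1 x + 4 * (x * tail x).
have gn n : x0 <= 2 ^+ n * x0 /\ g (2 ^+ n * x0) <= g x0.
  elim: n => [|n [xn ih]]; first by rewrite expr0 mul1r.
  rewrite exprS -mulrA; move: xn ih; set x := _ ^+ n * x0 => xn ih.
  have x1 : 0 < x by exact: lt_le_trans x00 xn.
  split; first by lra.
  apply: le_trans ih; rewrite /g.
  have := tmoment1_double Y x1.
  have [_] := HM x (lt_le_trans x0M xn).
  by have := tail_ge0 Y x; nra.
exists (g x0) => x xpos.
have [n nx] : exists n, x <= 2 ^+ n * x0.
  exists (Num.bound (x / x0)).
  rewrite -ler_pdivrMr//; apply: ltW; apply: (lt_trans (archi_boundP _)).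
    by rewrite divr_ge0// ltW.
  by rewrite -natrX ltr_nat ltn_expl.
have [xn] := gn n; apply: le_trans.
apply: (le_trans (le_tmoment Y 1 (ltW xpos) nx)).
by rewrite lerDl mulr_ge0// mulr_ge0 ?tail_ge0//; lra.
Qed.

Let mu1 := fine (moment Y 1).

Lemma moment1_fin_num : moment Y 1 \is a fin_num.
Proof. by have [B /(tmoment_cvg_fin (n := 1%N))[]] := tmoment1_bounded. Qed.

Lemma tmoment1_cvg e : 0 < e -> \forall x \near +oo, mu1 - e <= tmoment 1 x <= mu1.
Proof.
by have [B /(tmoment_cvg_fin (n := 1%N))[_ h]] := tmoment1_bounded; exact: h.
Qed.

Lemma tmoment1_le x : 0 <= x -> tmoment 1 x <= mu1.
Proof.
move=> x0; have := @tmoment_le_moment 1 x x0.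
by rewrite -[X in (_ <= X)%E](fineK moment1_fin_num) lee_fin.
Qed.

(** Half of [x * tail x] is at most the increment of the truncated mean from [x / 2] to [x], and
    that mean converges. *)
Lemma tail_cvg0 e : 0 < e -> \forall x \near +oo, x * tail x <= e.
Proof.
move=> e0; have e20 : 0 < e / 2 by lra.
have h0 : (0 : R) < 2^-1 by lra.
have := near_pinftyI (near_pinfty_scale h0 (tmoment1_cvg e20)) (@near_pinfty_gt R 0).
apply: filterS => x [/andP[h1 _] x0]; have := tmoment1_half Y x0.
have := tmoment1_le (ltW x0); move: h1; rewrite (mulrC 2^-1); lra.
Qed.

(** Split at [c * x]: the lower part is at most [c * x * mu1], which fixes [c]; the upper part is
    [x ^+ 2 * tail (c * x)], small by [tail_cvg0] once [c] is fixed. *)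
Lemma tmoment2_small e : 0 < e -> \forall x \near +oo, tmoment 2 x <= e * x.
Proof.
move=> e0.
have mu0 : 0 <= mu1 by apply: le_trans (tmoment1_le (lexx 0)); exact: tmoment_ge0.
pose c := Num.min 1 (e / (2 * (mu1 + 1))).
have c0 : 0 < c by rewrite lt_min ltr01 divr_gt0//; lra.
have c1 : c <= 1 by rewrite /c ge_min lexx.
have cmu : c * mu1 <= e / 2.
  have : c <= e / (2 * (mu1 + 1)) by rewrite /c ge_min lexx orbT.
  by rewrite ler_pdivlMr; [nra|lra].
have d0 : 0 < e / 2 * c by rewrite mulr_gt0//; lra.
have := near_pinftyI (near_pinfty_scale c0 (tail_cvg0 d0)) (@near_pinfty_gt R 0).
apply: filterS => x [h1 x0].
have c01 : 0 < c <= 1 by rewrite c0.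
have := tmoment_doubling Y 1 x0 c01; rewrite addn1 !expr1 => h2.
have h3 := tmoment1_le (ltW x0).
have h4 : x * tail (c * x) <= e / 2.
  by rewrite -(ler_pM2l c0) [leRHS]mulrC; apply: le_trans h1; rewrite mulrA.
apply: (le_trans h2); have : c * x * tmoment 1 x <= c * x * mu1.
  by apply: ler_wpM2l => //; rewrite mulr_ge0// ltW.
nra.
Qed.

(** The same split with squares: the lower part is at most [c^2 x^2 W x], the upper one is
    [x^4 tail (c x)], to which [tail_negligible] applies at [c x]. *)
Lemma tmoment4_negligible e : 0 < e ->
  \forall x \near +oo, tmoment 4 x <= e * (x ^+ 2 * tmoment 2 x).
Proof.
move=> e0; pose c := Num.min 1 (e / 2).
have c0 : 0 < c by rewrite lt_min ltr01 divr_gt0.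
have c1 : c <= 1 by rewrite /c ge_min lexx.
have ce : c <= e / 2 by rewrite /c ge_min lexx orbT.
(* Makes [2 / (K c^2) <= e / 2], the factor met when [x^2 tail (c x)] is compared with [W (c x)]. *)
pose K := Num.bound (4 / (e * c ^+ 2)).
have Ke : 2 <= K%:R / 2 * (e * c ^+ 2).
  have ec : 0 < e * c ^+ 2 by rewrite mulr_gt0// exprn_gt0.
  have : 4 / (e * c ^+ 2) <= K%:R.
    by apply/ltW/archi_boundP; rewrite divr_ge0// ltW.
  by rewrite ler_pdivrMr//; lra.
have := near_pinftyI (near_pinfty_scale c0 (tail_negligible K)) (@near_pinfty_gt R 0).
apply: filterS => x [h1 x0].
have c01 : 0 < c <= 1 by rewrite c0.
have := tmoment_doubling Y 2 x0 c01; have -> : (2 + 2 = 4)%N by [].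
move=> h2.
apply: (le_trans h2).
have Wc : tmoment 2 (c * x) <= tmoment 2 x by apply: le_tmoment; nra.
have W0 : 0 <= tmoment 2 x by rewrite tmoment_ge0// ltW.
have t0 : 0 <= tail (c * x) by exact: tail_ge0.
have h3 : c ^+ 2 <= e / 2 by nra.
have h4 : x ^+ 2 * tail (c * x) <= e / 2 * tmoment 2 x.
  have : 2 * (x ^+ 2 * tail (c * x)) <= K%:R / 2 * (e * c ^+ 2) * (x ^+ 2 * tail (c * x)).
    by apply: ler_wpM2r => //; rewrite mulr_ge0// sqr_ge0.
  have : e * (K%:R / 2 * ((c * x) ^+ 2 * tail (c * x))) <= e * tmoment 2 x.
    by apply: ler_wpM2l; [exact: ltW|exact: le_trans h1 Wc].
  rewrite exprMn; lra.
have h5 : x ^+ 2 * (x ^+ 2 * tail (c * x)) <= x ^+ 2 * (e / 2 * tmoment 2 x).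
  by apply: ler_wpM2l => //; exact: sqr_ge0.
have h6 : c ^+ 2 * (x ^+ 2 * tmoment 2 x) <= e / 2 * (x ^+ 2 * tmoment 2 x).
  by apply: ler_wpM2r => //; rewrite mulr_ge0// sqr_ge0.
rewrite exprMn; have -> : x ^+ 4 = x ^+ 2 * x ^+ 2 by rewrite -exprD.
lra.
Qed.

(** [W x <= x mu1], and [W x] reaches 1. *)
Lemma moment1_gt0 : moment Y 2 = +oo%E -> 0 < mu1.
Proof.
move=> mu2; have := near_pinftyI (@tmoment_cvgy 2 mu2 1) (@near_pinfty_gt R 0).
move=> /filter_ex[x [h1 x0]].
rewrite -(pmulr_rgt0 _ x0); apply: (lt_le_trans ltr01); apply: (le_trans h1).
apply: (le_trans (tmoment2_le Y (ltW x0))).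
by rewrite ler_pM2l// tmoment1_le// ltW.
Qed.

End TailRegularVariation.

(** * Truncated second moment and the log integral *)

Section LayerCake.
Context {d : measure_display} {T : measurableType d} {R : realType}.
Variables (P : probability T R) (Y : {RV P >-> R}).
Local Notation mu := (@lebesgue_measure R).

Lemma integral_2id (z : R) : 0 <= z ->
  (\int[mu]_(u in `]0%R, z]) (2 * u)%:E = (z ^+ 2)%:E)%E.
Proof.
move=> z0; have m2 : measurable_fun setT (fun u : R => 2 * u).
  by apply: measurable_funM; [exact: measurable_cst|exact: measurable_id].
rewrite integral_itv_obnd_cbnd; last first.
  by apply/measurable_EFinP; exact: measurable_funTS.
move: z0; rewrite le_eqVlt => /predU1P[<-|z0].
  by rewrite set_itv1 integral_set1 expr0n.
have cF (x : R) : {for x, continuous (fun u : R => u ^+ 2)}.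
  exact: exprn_continuous.
rewrite (@continuous_FTC2 _ (fun u => 2 * u) (fun u => u ^+ 2)) //.
- by rewrite expr0n/= sube0.
- apply: continuous_subspaceT => u; apply: cvgM; first exact: cvg_cst.
  exact: cvg_id.
- split => [u _||].
  + exact: exprn_derivable.
  + by apply: cvg_at_right_filter; exact: cF.
  + by apply: cvg_at_left_filter; exact: cF.
- move=> u _; rewrite derive1E exp_derive expr1 scaler1.
  by rewrite -mulr_natl.
Qed.

Lemma measurable_fun_tail : measurable_fun setT (tail Y).
Proof.
rewrite (_ : tail Y = fine \o ccdf Y); last first.
  apply/funext => u; rewrite /tail /prob /ccdf /distribution /pushforward /=.
  by congr (fine (P _)); apply/seteqP; split => w /=; rewrite in_itv/= andbT.
apply/measurable_EFinP; apply: eq_measurable_fun (@ccdf_measurable _ _ _ P Y) => u _ /=.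
by rewrite fineK// fin_num_measure.
Qed.

(** The squared truncation of [y] is the integral of [2 u] over those [u] in []0, x]] with [u < y];
    Tonelli's theorem exchanges this integral with the expectation. *)
Lemma tmoment2_layer_cake x : 0 <= x ->
  ((tmoment Y 2 x)%:E = \int[mu]_(u in `]0%R, x]) (2 * u * tail Y u)%:E)%E.
Proof.
move=> x0; rewrite /tmoment EFin_Ex; last exact: bounded_trunc.
pose f (p : T * R) : \bar R :=
  (if (0 < p.2) && (p.2 <= x) && (p.2 < Y p.1) then 2 * p.2 else 0)%:E.
have f0 p : (0 <= f p)%E.
  by rewrite lee_fin; case: ifP => // /andP[/andP[h _] _]; rewrite mulr_ge0// ltW.
have mf : measurable_fun setT f.
  apply/measurable_EFinP; apply: measurable_fun_ifT.
  - apply: measurable_and; first apply: measurable_and.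
    + by apply: measurable_fun_ltr => //; exact: measurable_cst.
    + by apply: measurable_fun_ler => //; exact: measurable_cst.
    + by apply: measurable_fun_ltr => //; apply: measurableT_comp.
  - by apply: measurable_funM => //; exact: measurable_cst.
  - exact: measurable_cst.
transitivity (\int[P]_w \int[mu]_u f (w, u))%E.
  apply: eq_integral => w _; rewrite /f/=.
  have ifE (D : set R) : (forall u, D u <-> (0 < u) && (u <= x) && (u < Y w)) ->
      (\int[mu]_u (if (0 < u) && (u <= x) && (u < Y w) then 2 * u else 0)%:E =
       \int[mu]_(u in D) (2 * u)%:E)%E.
    move=> HD; rewrite [RHS]integral_mkcond; apply: eq_integral => u _.
    rewrite patchE; case: ifPn => [/HD/mem_set ->//|/negP uD].
    by rewrite memNset// => /HD.
  case: (trunc_spec (Y w) x0) => [[Y0 ->]|[Y0 Yx ->]|[Y0 Yx ->]].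
  - rewrite expr0n (ifE set0) ?integral_set0// => u; split => // /andP[/andP[u0 _] uY].
    lra.
  - rewrite (ifE `]0, Y w[%classic); last first.
      move=> u; rewrite /= in_itv/=; split => [/andP[-> uY]|].
        by rewrite uY andbT/= (le_trans (ltW uY)).
      by move=> /andP[/andP[-> _] ->].
    rewrite integral_itv_bndo_bndc ?integral_2id ?ltW//.
    apply/measurable_EFinP/measurable_funTS.
    by apply: measurable_funM; [exact: measurable_cst|exact: measurable_id].
  - rewrite (ifE `]0, x]%classic) ?integral_2id// => u; rewrite /= in_itv/=.
    split => [/andP[-> ux]|/andP[/andP[-> ->]]//].
    by rewrite ux (le_lt_trans ux).
rewrite (fubini_tonelli (m1 := P) (m2 := mu) f)//= [RHS]integral_mkcond.
apply: eq_integral => u _; rewrite patchE /f/=.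
case: ifPn => [|].
  rewrite inE/= in_itv/= => /andP[u0 ux]; rewrite u0 ux/=.
  have mt := measurable_tail Y u.
  rewrite /tail -Ex_indic// -ExZ; last exact: bounded_rv_indic.
  rewrite EFin_Ex; last first.
    by apply: bounded_rvM; [exact: bounded_rv_cst|exact: bounded_rv_indic].
  apply: eq_integral => w _; rewrite indicE; case: ifPn => uY.
    by rewrite mem_set ?mulr1.
  by rewrite memNset ?mulr0//= (negbTE uY).
rewrite notin_setE/= in_itv/= => /negP/negbTE ->.
by rewrite integral0.
Qed.

End LayerCake.

(** * From the Pareto tail to the equivalence of [W] with twice the log integral *)

Section Pareto.
Context {d : measure_display} {T : measurableType d} {R : realType}.
Variables (P : probability T R) (Y : {RV P >-> R}) (l : R -> R).
Hypothesis Ypos : P [set w | 0 < Y w] = 1%E.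
Hypothesis Ypareto : pareto_type 2 (fun x => fine (cdf Y x)) l.
Local Notation mu := (@lebesgue_measure R).
Local Notation tail := (tail Y).
Local Notation tmoment := (tmoment Y).

Lemma cvg1_near (f : R -> R) (e : R) : f x @[x --> +oo] --> (1 : R) -> 0 < e ->
  \forall x \near +oo, 1 - e <= f x <= 1 + e.
Proof.
move=> /cvgrPdist_le h e0; apply: filterS (h e e0) => x.
by rewrite ler_norml => /andP[h1 h2]; apply/andP; split; lra.
Qed.

Lemma tail_cdf x : tail x = 1 - fine (cdf Y x).
Proof.
have -> : tail x = fine (ccdf Y x).
  rewrite /tail /prob /ccdf /distribution /pushforward /=.
  by congr (fine (P _)); apply/seteqP; split => w /=; rewrite in_itv/= andbT.
have h1 : cdf Y x \is a fin_num by rewrite fin_num_measure.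
have h2 : ccdf Y x \is a fin_num by rewrite fin_num_measure.
apply: EFin_inj; rewrite EFinB !fineK//; exact: ccdf_1_cdf.
Qed.

Lemma pareto_tail_equiv e : 0 < e -> \forall x \near +oo,
  (1 - e) * l x <= x ^+ 2 * tail x <= (1 + e) * l x.
Proof.
move=> e0; have [_ [_ lpos _] h] := Ypareto.
have h' := cvg1_near h e0.
have := near_pinftyI (near_pinftyI h' lpos) (@near_pinfty_gt R 0).
apply: filterS => x [[]]; rewrite -tail_cdf => h1 l0 x0.
have E : x `^ (- 2) = (x ^+ 2)^-1 by rewrite powRN powR_mulrn// ltW.
have D : tail x / (x `^ (-2) * l x) = x ^+ 2 * tail x / l x.
  by rewrite E; field; rewrite !gt_eqF.
by move: h1; rewrite D ler_pdivlMr// ler_pdivrMr.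
Qed.

Lemma pareto_tail_rv2 : tail_rv2 Y.
Proof.
move=> e e0; have [_ [_ lpos lsv] _] := Ypareto.
(* Ensures [1 + c <= (1 + e) (1 - c)^2] and [(1 + c)^2 <= (1 + e) (1 - c)]: two uses of the tail
   equivalence and one of slow variation at ratio 2. *)
pose c := Num.min (1 / 4) (e / 16).
have c0 : 0 < c by rewrite lt_min; apply/andP; split; lra.
have c1 : c <= 1 / 4 by rewrite /c ge_min lexx.
have c2 : c <= e / 16 by rewrite /c ge_min lexx orbT.
have h2 := pareto_tail_equiv c0.
have h3 := cvg1_near (lsv 2 (ltr0n R 2)) c0.
have := near_pinftyI (near_pinftyI h2 (near_pinfty_scale (ltr0n R 2) h2))
  (near_pinftyI h3 lpos).
move=> /near_pinftyI/(_ (near_pinfty_gt 0)).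
apply: filterS => x [[[/andP[a1 a2] /andP[b1 b2]] [h l0]] x0].
move: h; rewrite ler_pdivlMr// ler_pdivrMr// => /andP[k1 k2].
have x20 : 0 < x ^+ 2 by rewrite exprn_gt0.
have E : (2 * x) ^+ 2 * tail (2 * x) = x ^+ 2 * (4 * tail (2 * x)) by ring.
rewrite {}E in b1 b2.
split.
  rewrite -(ler_pM2l x20); apply: (le_trans a2).
  rewrite mulrCA; apply: (@le_trans _ _ ((1 + e) * ((1 - c) * l (2 * x)))); last first.
    by apply: ler_wpM2l => //; lra.
  apply: (@le_trans _ _ ((1 + e) * ((1 - c) * ((1 - c) * l x)))); last first.
    by apply: ler_wpM2l; [lra|]; apply: ler_wpM2l => //; lra.
  by rewrite !mulrA; apply: ler_wpM2r; [exact: ltW|nra].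
rewrite -(ler_pM2l x20); apply: (le_trans b2).
rewrite mulrCA; apply: (@le_trans _ _ ((1 + e) * ((1 - c) * l x))); last first.
  by apply: ler_wpM2l => //; lra.
apply: (@le_trans _ _ ((1 + c) * ((1 + c) * l x))).
  by apply: ler_wpM2l => //; lra.
by rewrite !mulrA; apply: ler_wpM2r; [exact: ltW|nra].
Qed.

Hypothesis mu2 : moment Y 2 = +oo%E.

(** Taking [fine] loses nothing under the integrability assumed next, which
    [log_integrand_integrable] later derives from [normalizing]. *)
Definition flog_integral (x : R) : R := fine (log_integral l x).

Hypothesis lint : forall b, 0 < b ->
  mu.-integrable `]0, b]%classic (EFin \o (fun u : R => l u / u)).

Lemma tmoment2_sub (x0 x : R) : 0 <= x0 -> x0 <= x ->
  mu.-integrable `]x0, x]%classic (EFin \o (fun u : R => 2 * u * tail u)) /\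
  tmoment 2 x - tmoment 2 x0 = \int[mu]_(u in `]x0, x]) (2 * u * tail u).
Proof.
move=> x00 x0x; have xge0 := le_trans x00 x0x.
have mf : measurable_fun setT (fun u : R => 2 * u * tail u).
  apply: measurable_funM; last exact: measurable_fun_tail.
  by apply: measurable_funM; [exact: measurable_cst|exact: measurable_id].
have fint : mu.-integrable `]0, x]%classic (EFin \o (fun u : R => 2 * u * tail u)).
  apply/integrableP; split; first by apply/measurable_EFinP; exact: measurable_funTS.
  rewrite integral_fin_num_abs//; last exact: measurable_funTS.
  by rewrite -tmoment2_layer_cake.
split.
  apply: integrableS fint => // u /=; rewrite !in_itv/= => /andP[u0 ->].
  by rewrite (le_lt_trans x00).
have E y : 0 <= y -> tmoment 2 y = \int[mu]_(u in `]0, y]) (2 * u * tail u).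
  by move=> y0; rewrite /Rintegral -tmoment2_layer_cake.
by rewrite !E// Rintegral_itvB// bnd_simp.
Qed.

Lemma flog_integral_sub (x0 x : R) : 0 <= x0 -> 0 < x -> x0 <= x ->
  flog_integral x - flog_integral x0 = \int[mu]_(u in `]x0, x]) (l u / u).
Proof.
move=> x00 xp x0x; rewrite /flog_integral /log_integral.
by rewrite -(Rintegral_itvB (lint xp) (x := x0)) ?bnd_simp.
Qed.

(** Beyond some [x0] the integrands [2 u tail u] and [2 l u / u] agree up to factors [1 - e] and
    [1 + e]. The integrals over []0, x0]] contribute constants only, absorbed by [e W x] as [W]
    diverges. *)
Lemma tmoment2_flog_integral e : 0 < e -> \forall x \near +oo,
  (1 - e) * tmoment 2 x <= (1 + e) * (2 * flog_integral x) /\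
  (1 - e) * (2 * flog_integral x) <= (1 + e) * tmoment 2 x.
Proof.
move=> e0; have [M [_ HM]] := pareto_tail_equiv e0.
pose x0 : R := `|M| + 1.
have x0M : M < x0 by rewrite /x0; have := ler_norm M; lra.
have x00 : 0 < x0 by rewrite /x0; have := normr_ge0 M; lra.
pose W0 := tmoment 2 x0; pose J0 := flog_integral x0.
(* Bounds the constants left by the upper and by the lower comparison. *)
pose C : R := `|W0 - 2 * (1 + e) * J0| + `|W0 - 2 * (1 - e) * J0|.
have := near_pinftyI (tmoment_cvgy Ypos mu2 (C / e)) (near_pinfty_gt x0).
apply: filterS => x [Wx x0x].
have xpos : 0 < x by lra.
have [Wint EW] := tmoment2_sub (ltW x00) (ltW x0x).
have EJ := flog_integral_sub (ltW x00) xpos (ltW x0x).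
have Jint : mu.-integrable `]x0, x]%classic (EFin \o (fun u : R => l u / u)).
  apply: integrableS (lint xpos) => // u /=; rewrite !in_itv/= => /andP[u0 ->].
  by rewrite (lt_trans x00).
have Jint2 r : mu.-integrable `]x0, x]%classic (EFin \o (fun u : R => r * (l u / u))).
  have -> : EFin \o (fun u : R => r * (l u / u)) = (fun u : R => r%:E * (l u / u)%R%:E)%E.
    by apply/funext => u /=; rewrite EFinM.
  exact: integrableZl.
have pt u : x0 < u -> 2 * (1 - e) * (l u / u) <= 2 * u * tail u <= 2 * (1 + e) * (l u / u).
  move=> x0u; have u0 : 0 < u by lra.
  have /andP[h1 h2] := HM u (lt_trans x0M x0u).
  have -> : 2 * u * tail u = 2 / u * (u ^+ 2 * tail u) by field; rewrite gt_eqF.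
  have K a : 2 * a * (l u / u) = 2 / u * (a * l u) by field; rewrite gt_eqF.
  have u20 : 0 < 2 / u by rewrite divr_gt0.
  by rewrite !K !ler_pM2l// h1 h2.
have up : tmoment 2 x - W0 <= 2 * (1 + e) * (flog_integral x - J0).
  rewrite EW EJ -RintegralZl//; apply: le_Rintegral => // u /=.
  by rewrite in_itv/= => /andP[/pt/andP[_ ?] _].
have lo : 2 * (1 - e) * (flog_integral x - J0) <= tmoment 2 x - W0.
  rewrite EW EJ -RintegralZl//; apply: le_Rintegral => // u /=.
  by rewrite in_itv/= => /andP[/pt/andP[? _] _].
have CW : C <= e * tmoment 2 x by rewrite mulrC -ler_pdivrMr.
have := ler_norm (W0 - 2 * (1 + e) * J0).
have := ler_norm (- (W0 - 2 * (1 - e) * J0)); rewrite normrN.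
move: CW; rewrite /C.
have := normr_ge0 (W0 - 2 * (1 + e) * J0).
have := normr_ge0 (W0 - 2 * (1 - e) * J0).
split; lra.
Qed.

End Pareto.

(** * Truncated moments along the normalizing function *)

Section Normalizing.
Context {d : measure_display} {T : measurableType d} {R : realType}.
Variables (P : probability T R) (Y : {RV P >-> R}) (l a : R -> R).
Hypothesis Ypos : P [set w | 0 < Y w] = 1%E.
Hypothesis Ypareto : pareto_type 2 (fun x => fine (cdf Y x)) l.
Hypothesis mu2 : moment Y 2 = +oo%E.
Hypothesis al : normalizing l a.
Local Notation mu := (@lebesgue_measure R).
Local Notation tail := (tail Y).
Local Notation tmoment := (tmoment Y).

Lemma measurable_inv_pos : measurable_fun (`]0, +oo[ : set R) (fun x : R => x^-1).
Proof.
apply: open_continuous_measurable_fun; first exact: interval_open.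
move=> x; rewrite inE/= in_itv/= andbT => x0.
by apply: inv_continuous; rewrite gt_eqF.
Qed.

Lemma near_normalizing (S : set R) : (\forall x \near +oo, S x) ->
  \forall t \near +oo, S (a t).
Proof. by case: al => ay _ HS; exact: (ay S HS). Qed.

(** A positive multiple of an infinite value is infinite, whereas the product converges to 1. *)
Lemma log_integral_fin_num : \forall t \near +oo, log_integral l (a t) \is a fin_num.
Proof.
have [_ /fine_cvgP[h _]] := al.
have := near_pinftyI (near_pinftyI h (near_normalizing (near_pinfty_gt 0))) (near_pinfty_gt 0).
apply: filterS => t [[+ at0] t0].
have c0 : 0 < t * a t ^- 2 by rewrite divr_gt0// exprn_gt0.
case: (log_integral l (a t)) => [r//||] /=.
  by rewrite gt0_muley// lte_fin.
by rewrite gt0_muleNy// lte_fin.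
Qed.

Lemma log_integrand_integrable b : 0 < b ->
  mu.-integrable `]0, b]%classic (EFin \o (fun u : R => l u / u)).
Proof.
move=> b0; have := near_pinftyI log_integral_fin_num (near_normalizing (near_pinfty_gt b)).
move=> /filter_ex[t [h bt]].
have [_ [ml _ _] _] := Ypareto.
have mf : measurable_fun (`]0, a t] : set R) (fun u : R => l u / u).
  apply: (@measurable_funS _ _ _ _ (`]0, +oo[ : set R)) => //.
    by move=> u /=; rewrite !in_itv/= => /andP[->].
  by apply: measurable_funM => //; exact: measurable_inv_pos.
have hint : mu.-integrable `]0, a t]%classic (EFin \o (fun u : R => l u / u)).
  apply/integrableP; split; first exact/measurable_EFinP.
  (* The sign of [l] near 0 is unknown; a finite integral still excludes an infinite positive or
     negative part. *)
  by rewrite integral_fin_num_abs.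
apply: integrableS hint => // u /=; rewrite !in_itv/= => /andP[-> ub].
exact: le_trans ub (ltW bt).
Qed.

Lemma normalizing_flog : t * (a t) ^- 2 * flog_integral l (a t) @[t --> +oo] --> (1 : R).
Proof.
have [_ /fine_cvgP[_ h]] := al.
apply: cvg_trans h; apply: near_eq_cvg.
apply: filterS log_integral_fin_num => t ft /=.
by rewrite fineM.
Qed.

Lemma normalizing_tmoment2 e : 0 < e -> \forall t \near +oo,
  0 < a t /\ `|t * (a t) ^- 2 * tmoment 2 (a t) - 2| <= e.
Proof.
move=> e0; pose c := Num.min (1 / 2) (e / 28).
have c0 : 0 < c by rewrite lt_min; apply/andP; split; lra.
have c1 : c <= 1 / 2 by rewrite /c ge_min lexx.
have c2 : c <= e / 28 by rewrite /c ge_min lexx orbT.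
have := near_pinftyI (near_normalizing (near_pinftyI (near_pinfty_gt 0)
  (tmoment2_flog_integral Ypos Ypareto mu2 log_integrand_integrable c0)))
  (near_pinftyI (cvg1_near normalizing_flog c0) (near_pinfty_gt 0)).
apply: filterS => t [[at0 [h1 h2]] [/andP[s1 s2] t0]]; split => //.
have q0 : 0 < t * a t ^- 2 by rewrite divr_gt0// exprn_gt0.
set q := t * a t ^- 2 in q0 s1 s2 *.
set W := tmoment 2 (a t) in h1 h2 *; set J := flog_integral l (a t) in h1 h2 s1 s2.
have g1 : (1 - c) * (q * W) <= (1 + c) * (2 * (q * J)).
  have : q * ((1 - c) * W) <= q * ((1 + c) * (2 * J)) by rewrite ler_pM2l.
  lra.
have g2 : (1 - c) * (2 * (q * J)) <= (1 + c) * (q * W).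
  have : q * ((1 - c) * (2 * J)) <= q * ((1 + c) * W) by rewrite ler_pM2l.
  lra.
move: g1 g2 s1 s2; set Q := q * W; set s := q * J => g1 g2 s1 s2.
have k1 : (1 - c) * Q <= 2 * ((1 + c) * (1 + c)).
  apply: (le_trans g1); rewrite mulrCA ler_pM2l//; apply: ler_wpM2l => //; lra.
have k2 : 2 * ((1 - c) * (1 - c)) <= (1 + c) * Q.
  apply: le_trans g2; rewrite [leRHS]mulrCA ler_pM2l//; apply: ler_wpM2l => //; lra.
have cc : c * c <= c / 2 by rewrite ler_pM2l//; lra.
rewrite ler_norml; apply/andP; split.
  have : (1 + c) * (2 - e) <= (1 + c) * Q by nra.
  rewrite ler_pM2l; lra.
have : (1 - c) * Q <= (1 - c) * (2 + e) by nra.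
rewrite ler_pM2l; lra.
Qed.

Lemma normalizing_tail e : 0 < e -> \forall t \near +oo, t * tail (a t) <= e.
Proof.
move=> e0; pose K := Num.bound (6 / e).
have Ke : 6 <= K%:R * e.
  have : 6 / e <= K%:R by apply/ltW/archi_boundP; rewrite divr_ge0// ltW.
  by rewrite ler_pdivrMr.
have K0 : 0 < K%:R :> R by rewrite -(pmulr_lgt0 _ e0); lra.
have Hn := tail_negligible (pareto_tail_rv2 Ypareto) K.
have := near_pinftyI (near_normalizing Hn)
  (near_pinftyI (normalizing_tmoment2 ltr01) (near_pinfty_gt 0)).
apply: filterS => t [h [[at0 +] t0]]; rewrite ler_norml => /andP[_ h2].
have q0 : 0 < t * a t ^- 2 by rewrite divr_gt0// exprn_gt0.
have E : t * tail (a t) = t * a t ^- 2 * (a t ^+ 2 * tail (a t)).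
  by field; rewrite gt_eqF.
rewrite E; move: h h2 q0; set q := t * a t ^- 2; set V := a t ^+ 2 * tail _; set W := tmoment _ _.
move=> h h2 q0.
have : q * (K%:R / 2 * V) <= q * W by rewrite ler_pM2l.
by move=> ?; rewrite -(ler_pM2l K0); lra.
Qed.

Lemma normalizing_tmoment4 e : 0 < e -> \forall t \near +oo,
  t * (a t) ^- 4 * tmoment 4 (a t) <= e.
Proof.
move=> e0; have e3 : 0 < e / 3 by lra.
have Hn := tmoment4_negligible (pareto_tail_rv2 Ypareto) e3.
have := near_pinftyI (near_normalizing Hn)
  (near_pinftyI (normalizing_tmoment2 ltr01) (near_pinfty_gt 0)).
apply: filterS => t [h [[at0 +] t0]]; rewrite ler_norml => /andP[_ h2].
have q0 : 0 < t * a t ^- 4 by rewrite divr_gt0// exprn_gt0.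
have : t * a t ^- 4 * tmoment 4 (a t) <= t * a t ^- 4 * (e / 3 * (a t ^+ 2 * tmoment 2 (a t))).
  by rewrite ler_pM2l.
move=> /le_trans; apply.
have -> : t * a t ^- 4 * (e / 3 * (a t ^+ 2 * tmoment 2 (a t))) =
  e / 3 * (t * a t ^- 2 * tmoment 2 (a t)) by field; rewrite gt_eqF.
have : e / 3 * (t * a t ^- 2 * tmoment 2 (a t)) <= e / 3 * 3.
  by rewrite ler_pM2l//; lra.
lra.
Qed.

End Normalizing.

(** * Weak laws uniform in the number of terms *)

Section UniformWeakLaw.
Context {d : measure_display} {T : measurableType d} {R : realType}.
Variables (P : probability T R) (X : nat -> {RV P >-> R}).
Hypotheses (Xpos : forall i, P [set w | 0 < X i w] = 1%E)
  (Xindep : mutually_independent X) (Xid : identically_distributed X).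
Local Notation tail0 := (tail (X 0%N)).
Local Notation tmoment := (tmoment (X 0%N)).

Definition power_sum (q k : nat) (w : T) : R := \sum_(i < k) X i w ^+ q.

Lemma measurable_power_sum q k : measurable_fun setT (power_sum q k).
Proof.
apply: measurable_sum => i; apply: measurable_funX; exact: measurable_funPT.
Qed.

Lemma tail_id i u : tail (X i) u = tail0 u.
Proof.
have E (Y : {RV P >-> R}) : tail Y u = fine (distribution P Y `]u, +oo[).
  rewrite /tail /prob /distribution /pushforward /=.
  by congr (fine (P _)); apply/seteqP; split => w /=; rewrite in_itv/= andbT.
by rewrite !E (Xid i 0%N).
Qed.

(** Off this event truncation at [c] leaves the first [k] variables unchanged. Nonpositive values
    are included because of the clipping at 0, and they cost no probability. *)
Definition untruncated (c : R) k :=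
  [set w : T | exists2 i, (i < k)%N & (X i w <= 0) || (c < X i w)].

Lemma untruncatedS c k : untruncated c k.+1 =
  untruncated c k `|` ([set w | X k w <= 0] `|` [set w | c < X k w]).
Proof.
apply/seteqP; split => w /=.
  move=> [i]; rewrite ltnS leq_eqVlt => /predU1P[->/orP h|ik h]; first by right.
  by left; exists i.
case => [[i ik h]|/orP h]; last by exists k.
by exists i => //; exact: ltnW.
Qed.

Lemma measurable_untruncated c k : measurable (untruncated c k).
Proof.
elim: k => [|k ih].
  have -> : untruncated c 0 = set0 by apply/seteqP; split => w // [].
  exact: measurable0.
rewrite untruncatedS; apply: measurableU => //; apply: measurableU.
  by apply: measurable_ger.
by apply: measurable_gtr.
Qed.

Lemma prob_untruncated c k : prob P (untruncated c k) <= k%:R * tail0 c.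
Proof.
elim: k => [|k ih].
  have -> : untruncated c 0 = set0 by apply/seteqP; split => w // [].
  by rewrite prob0 mul0r.
have m1 : measurable [set w | X k w <= 0] by apply: measurable_ger.
have m2 : measurable [set w | c < X k w] by apply: measurable_gtr.
rewrite untruncatedS -natr1 mulrDl mul1r.
apply: (le_trans (probU _ _ _)); [exact: measurable_untruncated|exact: measurableU|].
apply: lerD => //; apply: (le_trans (probU _ _ _)) => //.
by rewrite prob_le0// add0r -(tail_id k).
Qed.

(** A union bound for the event that truncation alters a term, plus Chebyshev's inequality for the
    truncated powers, whose second moment is the truncated moment of order [q + q]. *)
Lemma weak_law_power q k c e : 0 <= c -> 0 < e ->
  prob P [set w | e <= `|power_sum q k w - k%:R * tmoment q c|] <=
  k%:R * tail0 c + k%:R * tmoment (q + q) c / e ^+ 2.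
Proof.
move=> c0 e0.
pose h x : R := trunc c x ^+ q.
have mh : measurable_fun setT h.
  by apply: measurable_funX; exact: measurable_trunc.
have hM x : 0 <= h x <= c ^+ q by exact: truncX_bound.
have := weak_law_bounded k Xindep Xid mh hM e0.
set B := [set w | _] => HB.
have mB : measurable B.
  apply: measurable_ler; apply: measurableT_comp => //; apply: measurable_funB => //.
  by apply: measurable_sum => i; exact: measurableT_comp.
have -> : tmoment (q + q) c = Ex P (fun w => h (X 0%N w) ^+ 2).
  by congr Ex; apply/funext => w; rewrite /h -exprM muln2 addnn.
apply: (le_trans _ (lerD (prob_untruncated c k) HB)).
apply: le_probU => //.
- exact: measurable_untruncated.
- apply: measurable_ler; apply: measurableT_comp => //; apply: measurable_funB => //.
  exact: measurable_power_sum.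
- move=> w /= ew; have [uw|uw] := pselect (untruncated c k w); [by left|right].
  move: ew; congr (_ <= `| _ - _ |); apply: eq_bigr => i _; rewrite /h.
  case: (trunc_spec (X i w) c0) => [[Xi _]|[_ _ ->]//|[_ cX _]].
    by exfalso; apply: uw; exists i => //; rewrite Xi.
  by exfalso; apply: uw; exists i => //; rewrite cX orbT.
Qed.

(** Serves twice: [q = 1] with [b t = t], and [q = 2] with [b = a]. The function [b] is at once
    truncation level and norming. *)
Lemma uniform_weak_law q (b : R -> R) (c : R) :
  (\forall t \near +oo, 0 < b t) ->
  (forall e, 0 < e -> \forall t \near +oo,
     `|t * (b t) ^- q * tmoment q (b t) - c| <= e) ->
  (forall e, 0 < e -> \forall t \near +oo, t * tail0 (b t) <= e) ->
  (forall e, 0 < e -> \forall t \near +oo,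
     t * (b t) ^- (q + q) * tmoment (q + q) (b t) <= e) ->
  forall M eta e : R, 0 < M -> 0 < eta -> 0 < e -> \forall t \near +oo,
    forall k : nat, k%:R <= M * t ->
    prob P [set w | eta <= `|power_sum q k w / b t ^+ q - c * (k%:R / t)|] <= e.
Proof.
move=> b0 Hm Ht Hv M eta e M0 eta0 e0.
(* The three tolerances, for bias, truncation and variance, are divided by [M] since each enters
   multiplied by [k / t <= M]. *)
have e1 : 0 < eta / 2 / M by rewrite !divr_gt0.
have e2 : 0 < e / 2 / M by rewrite !divr_gt0.
have e3 : 0 < e / 2 * ((eta / 2) ^+ 2 / M).
  by rewrite mulr_gt0 ?divr_gt0// exprn_gt0// divr_gt0.
have := near_pinftyI (near_pinftyI b0 (near_pinfty_gt 0))
  (near_pinftyI (Hm _ e1) (near_pinftyI (Ht _ e2) (Hv _ e3))).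
apply: filterS => t [[bt0 t0] [h1 [h2 h3]]] k kM.
have bq0 : 0 < b t ^+ q by rewrite exprn_gt0.
have kt0 : 0 <= k%:R / t by rewrite divr_ge0// ltW.
have ktM : k%:R / t <= M by rewrite ler_pdivrMr.
pose e' := eta / 2 * b t ^+ q.
have e'0 : 0 < e' by rewrite mulr_gt0// divr_gt0.
have := weak_law_power q k (ltW bt0) e'0.
have h4 : k%:R * tail0 (b t) <= e / 2.
  have -> : k%:R * tail0 (b t) = k%:R / t * (t * tail0 (b t)) by field; rewrite gt_eqF.
  have -> : e / 2 = M * (e / 2 / M) by field; rewrite gt_eqF.
  by apply: ler_pM => //; rewrite mulr_ge0 ?tail_ge0// ltW.
have h5 : k%:R * tmoment (q + q) (b t) / e' ^+ 2 <= e / 2.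
  have -> : k%:R * tmoment (q + q) (b t) / e' ^+ 2 =
      k%:R / t / (eta / 2) ^+ 2 * (t * b t ^- (q + q) * tmoment (q + q) (b t)).
    by rewrite /e' exprD; field; rewrite !gt_eqF.
  have -> : e / 2 = M / (eta / 2) ^+ 2 * (e / 2 * ((eta / 2) ^+ 2 / M)).
    by field; rewrite !gt_eqF.
  apply: ler_pM => //.
  - by rewrite divr_ge0// sqr_ge0.
  - by rewrite !mulr_ge0 ?tmoment_ge0 ?invr_ge0 ?exprn_ge0// ltW.
  - by rewrite ler_pM2r// invr_gt0 exprn_gt0// divr_gt0.
move=> h6; apply: (@le_trans _ _ (e / 2 + e / 2)); last by lra.
apply: le_trans (lerD h4 h5); apply: le_trans h6; apply: le_prob.
- apply: measurable_ler; apply: measurableT_comp => //; apply: measurable_funB => //.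
  by apply: measurable_funM => //; exact: measurable_power_sum.
- apply: measurable_ler; apply: measurableT_comp => //; apply: measurable_funB => //.
  exact: measurable_power_sum.
- move=> w /= h; rewrite /e'.
  set S := power_sum q k w in h *; set m := tmoment q (b t) in h1 *.
  (* The deviation from [c (k / t)] minus the deterministic bias of the truncated moment; each may
     use half of [eta]. *)
  have E : S - k%:R * m = b t ^+ q *
     ((S / b t ^+ q - c * (k%:R / t)) - k%:R / t * (t * b t ^- q * m - c)).
    by field; rewrite !gt_eqF.
  rewrite E normrM (gtr0_norm bq0) mulrC ler_pM2l//.
  have h7 : `|k%:R / t * (t * b t ^- q * m - c)| <= eta / 2.
    rewrite normrM ger0_norm//.
    have -> : eta / 2 = M * (eta / 2 / M) by field; rewrite gt_eqF.
    exact: ler_pM.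
  set x := S / _ - _ in h *; set y := _ / t * _ in h7 *.
  have := ler_normD (x - y) y; rewrite subrK; lra.
Qed.

End UniformWeakLaw.

(** * Substitution of an independent random index *)

Section RandomIndex.
Context {d : measure_display} {T : measurableType d} {R : realType}.
Variable P : probability T R.

Lemma measurable_random_index (F : nat -> T -> R) (N : {RV P >-> nat}) :
  (forall n, measurable_fun setT (F n)) ->
  measurable_fun setT (fun w => F (N w) w).
Proof.
move=> mF _ B mB; rewrite setTI.
have -> : (fun w => F (N w) w) @^-1` B =
    \bigcup_n (N @^-1` [set n] `&` F n @^-1` B).
  by apply/seteqP; split => w /=; [move=> h; exists (N w)|move=> [n _ [/= <-]]].
apply: bigcup_measurable => n _; apply: measurableI.
  by apply: measurable_funPTI.
by rewrite -[X in measurable X]setTI; exact: mF.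
Qed.

(** Partition by the value of [N]: independence gives the weight [P (N = n)] to each [P (B n)], and
    these weights sum to at most 1, so a bound for every fixed index survives without loss. *)
Lemma prob_random_index_lt (N : {RV P >-> nat}) (B : nat -> set T) (e : R) K :
  (forall n, measurable (B n)) -> 0 <= e ->
  (forall n, (n < K)%N -> prob P (B n) <= e) ->
  (forall n, P (B n `&` N @^-1` [set n]) = (P (B n) * P (N @^-1` [set n]))%E) ->
  prob P [set w | (N w < K)%N /\ B (N w) w] <= e.
Proof.
move=> mB e0 HB Hind.
have mN n : measurable (N @^-1` [set n]) by apply: measurable_funPTI.
have mNlt k : measurable [set w | (N w < k)%N].
  have -> : [set w | (N w < k)%N] = N @^-1` [set n | (n < k)%N] by [].
  by apply: measurable_funPTI.
suff H k : (k <= K)%N -> measurable [set w | (N w < k)%N /\ B (N w) w] /\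
    prob P [set w | (N w < k)%N /\ B (N w) w] <= e * prob P [set w | (N w < k)%N].
  have [_ h] := H K (leqnn K); apply: (le_trans h).
  by rewrite ler_piMr// prob_le1.
elim: k => [_|k ih kK].
  have -> : [set w | (N w < 0)%N /\ B (N w) w] = set0.
    by apply/seteqP; split => w // -[].
  split; first exact: measurable0.
  by rewrite prob0 mulr_ge0// prob_ge0.
have [m1 ih'] := ih (ltnW kK).
have E : [set w | (N w < k.+1)%N /\ B (N w) w] =
    [set w | (N w < k)%N /\ B (N w) w] `|` (B k `&` N @^-1` [set k]).
  apply/seteqP; split => w /=.
    move=> [+ Bw]; rewrite ltnS leq_eqVlt => /predU1P[Nk|Nk]; last by left.
    by right; rewrite -Nk.
  move=> [[Nk Bw]|[Bw ->]]; last by [].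
  by split => //; exact: ltnW.
have m2 : measurable (B k `&` N @^-1` [set k]) by exact: measurableI.
split; first by rewrite E; exact: measurableU.
rewrite E; apply: (le_trans (probU P m1 m2)).
have -> : prob P [set w | (N w < k.+1)%N] =
    prob P [set w | (N w < k)%N] + prob P (N @^-1` [set k]).
  have -> : [set w | (N w < k.+1)%N] = [set w | (N w < k)%N] `|` N @^-1` [set k].
    apply/seteqP; split => w /=.
      by rewrite ltnS leq_eqVlt => /predU1P[]; [right|left].
    by case => [|->//]; exact: ltnW.
  apply: EFin_inj; rewrite EFinD !probK//; last exact: measurableU.
  rewrite measureU//; apply/seteqP; split => w //= [+ Nk].
  by rewrite Nk ltnn.
rewrite mulrDr; apply: lerD => //.
rewrite -lee_fin EFinM !probK// Hind; apply: lee_wpmul2r => //.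
by rewrite -(probK P (mB k)) lee_fin; exact: HB.
Qed.

End RandomIndex.

(** * Convergence in law *)

Section WeakConvergence.
Context {d d' : measure_display} {T : measurableType d} {T' : measurableType d'}
  {R : realType}.
Variables (P : probability T R) (P' : probability T' R).

(** A monotone function has countably many discontinuities, while []z, z'[] has positive Lebesgue
    measure. *)
Lemma cdf_continuity_point (L : {RV P' >-> R}) (z z' : R) : z < z' ->
  exists y, [/\ z < y, y < z' &
    {for y, continuous (fun x : R => P' [set w | L w <= x])}].
Proof.
move=> zz'; pose F x := fine (cdf L x).
have FE x : (F x)%:E = cdf L x by rewrite fineK// fin_num_measure.
have Fnd : nondecreasing F.
  by move=> x y xy; rewrite -lee_fin !FE; exact: cdf_nondecreasing.
have ndF : {in `[z, z'] &, nondecreasing_fun F} by move=> x y _ _; exact: Fnd.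
have cD := discontinuity_countable ndF.
have [y [zyz' yD]] : exists y, z < y < z' /\ ~ discontinuity F y.
  apply/not_existsP => h.
  have cI : countable `]z, z'[%classic.
    apply: sub_countable cD; apply: subset_card_le => y /= yzz'.
    split => //; apply/not_notP => yD; apply: (h y); split => //.
  have := countable_lebesgue_measure0 cI.
  by rewrite lebesgue_measure_itv/= lte_fin zz' -EFinD => -[]/eqP; rewrite subr_eq0 gt_eqF.
exists y; move: zyz' => /andP[zy yz']; split => //.
have cr : F x @[x --> y^'+] --> F y.
  by apply: fine_cvg; rewrite FE; exact: cdf_right_continuous.
have cl : cvg (F x @[x --> y^'-]).
  apply: nondecreasing_at_left_is_cvgr.
  - by apply: nearW => a u v _ _; exact: Fnd.
  - apply: nearW => a; exists (F y) => _ /= [u uy <-]; apply/Fnd/ltW.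
    by move: uy; rewrite in_itv/= => /andP[].
have ll : lim (F x @[x --> y^'-]) = F y.
  apply/eqP; rewrite -(cvg_lim _ cr)//; apply/negPn/negP => ne.
  by apply: yD; split => //; apply/cvg_ex; exists (F y).
have Fc : F x @[x --> y] --> F y.
  by apply/left_right_continuousP; split => //; rewrite -ll.
have -> : (fun x : R => P' [set w | L w <= x]) = EFin \o F.
  apply/funext => x /=; rewrite FE /cdf /distribution /pushforward.
  by congr (P' _); apply/seteqP; split => w /=; rewrite in_itv/=.
by apply: cvg_EFin; [exact: nearW|exact: Fc].
Qed.

(** Convergence in law with the gap [z < z'] in place of continuity points, in the spirit of the
    Lévy metric. Perturbation, scaling and inversion then only move thresholds. *)
Definition law_close (Y : R -> T -> R) (Z : T' -> R) := forall z z' e : R,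
  z < z' -> 0 < e -> \forall t \near +oo,
    prob P [set w | Y t w <= z] <= prob P' [set w | Z w <= z'] + e /\
    prob P' [set w | Z w <= z] <= prob P [set w | Y t w <= z'] + e.

Lemma cvg_in_distribution_law_close (Y : R -> T -> R) (L : {RV P' >-> R}) :
  cvg_in_distribution P Y P' L -> law_close Y L.
Proof.
move=> [mY _ h] z z' e zz' e0.
have [y [zy yz' cy]] := cdf_continuity_point L zz'.
have := h y cy; rewrite -probK; last by apply: measurable_ger.
move=> /fine_cvgP[_ /cvgrPdist_le/(_ e e0)].
apply: filterS => t /=; rewrite -/(prob P _) ler_norml => /andP[h1 h2].
have l1 : prob P [set w | Y t w <= z] <= prob P [set w | Y t w <= y].
  apply: le_prob; [by apply: measurable_ger..|].
  by move=> w /= /le_trans; apply; exact: ltW.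
have l2 : prob P [set w | Y t w <= y] <= prob P [set w | Y t w <= z'].
  apply: le_prob; [by apply: measurable_ger..|].
  by move=> w /= /le_trans; apply; exact: ltW.
have l3 : prob P' [set w | L w <= z] <= prob P' [set w | L w <= y].
  apply: le_prob; [by apply: measurable_ger..|].
  by move=> w /= /le_trans; apply; exact: ltW.
have l4 : prob P' [set w | L w <= y] <= prob P' [set w | L w <= z'].
  apply: le_prob; [by apply: measurable_ger..|].
  by move=> w /= /le_trans; apply; exact: ltW.
by split; lra.
Qed.

(** At a continuity point [x], the gaps [(x - r / 2, x)] and [(x, x + r / 2)] squeeze the
    probability. *)
Lemma law_close_cvg (Y : R -> T -> R) (Z : T' -> R) :
  (forall t, measurable_fun setT (Y t)) -> measurable_fun setT Z ->
  law_close Y Z -> cvg_in_distribution P Y P' Z.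
Proof.
move=> mY mZ h; split => // x cx.
have mZx y : measurable [set w | Z w <= y] by apply: measurable_ger.
have mYx t y : measurable [set w | Y t w <= y] by apply: measurable_ger.
have {}cx : prob P' [set w | Z w <= y] @[y --> x] --> prob P' [set w | Z w <= x].
  by apply: fine_cvg; rewrite probK//; exact: cx.
rewrite -probK//; apply: cvg_EFin.
  by apply: nearW => t; rewrite fin_num_measure.
apply/cvgrPdist_le => e e0.
have e20 : 0 < e / 2 by lra.
have /cvgrPdist_le/(_ _ e20)[r /= r0 Hr] := cx.
have r20 : 0 < r / 2 by rewrite divr_gt0.
have lx : x - r / 2 < x by lra.
have xr : x < x + r / 2 by lra.
have := near_pinftyI (h _ _ _ lx e20) (h _ _ _ xr e20).
apply: filterS => t [[_ h1] [h2 _]].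
have /= := Hr (x - r / 2); rewrite /ball_/= opprB addrCA subrr addr0 gtr0_norm//.
move=> /(_ ltac:(lra)); rewrite ler_norml => /andP[_ h3].
have /= := Hr (x + r / 2); rewrite /ball_/= opprD addrA subrr add0r normrN gtr0_norm//.
move=> /(_ ltac:(lra)); rewrite ler_norml => /andP[h4 _].
rewrite /= -/(prob P _) ler_norml; apply/andP; split; lra.
Qed.

(** Slutsky's argument: half of the gap is spent on the perturbation, half on the closeness of [Y']
    to the limit. *)
Lemma law_close_perturb (Y Y' : R -> T -> R) (Z : T' -> R) :
  (forall t, measurable_fun setT (Y t)) -> (forall t, measurable_fun setT (Y' t)) ->
  (forall eta e : R, 0 < eta -> 0 < e -> \forall t \near +oo,
    prob P [set w | eta <= `|Y t w - Y' t w|] <= e) ->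
  law_close Y' Z -> law_close Y Z.
Proof.
move=> mY mY' hYY' h z z' e zz' e0.
have e20 : 0 < e / 2 by lra.
pose r := (z' - z) / 2.
have r0 : 0 < r by rewrite /r; lra.
pose y := (z + z') / 2.
have zy : z < y by rewrite /y; lra.
have yz' : y < z' by rewrite /y; lra.
have := near_pinftyI (hYY' r _ r0 e20) (near_pinftyI (h _ _ _ zy e20) (h _ _ _ yz' e20)).
apply: filterS => t [h1 [[h2 h3] [h4 h5]]].
have mB : measurable [set w | r <= `|Y t w - Y' t w|].
  by apply: measurable_ler; apply: measurableT_comp => //; exact: measurable_funB.
have l1 : prob P [set w | Y t w <= z] <= prob P [set w | Y' t w <= y] +
    prob P [set w | r <= `|Y t w - Y' t w|].
  apply: le_probU => //; [by apply: measurable_ger..|].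
  move=> w /= Yz; have [?|b] := leP (Y' t w) y; [by left|right].
  by rewrite -normrN opprB; apply: le_trans (ler_norm _); rewrite /r /y in b Yz *; lra.
have l2 : prob P [set w | Y' t w <= y] <= prob P [set w | Y t w <= z'] +
    prob P [set w | r <= `|Y t w - Y' t w|].
  apply: le_probU => //; [by apply: measurable_ger..|].
  move=> w /= Yz; have [?|b] := leP (Y t w) z'; [by left|right].
  by apply: le_trans (ler_norm _); rewrite /r /y in b Yz *; lra.
by split; lra.
Qed.

Lemma law_closeZ (Y : R -> T -> R) (Z : T' -> R) (c : R) : 0 < c ->
  law_close Y Z -> law_close (fun t w => c * Y t w) (fun w => c * Z w).
Proof.
move=> c0 h z z' e zz' e0.
have zz'c : z / c < z' / c by rewrite ltr_pM2r// invr_gt0.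
have E y u : (c * u <= y) = (u <= y / c) by rewrite ler_pdivlMr// mulrC.
apply: filterS (h _ _ _ zz'c e0) => t.
have S1 y : [set w | c * Y t w <= y] = [set w | Y t w <= y / c].
  by apply/seteqP; split => w /=; rewrite E.
have S2 y : [set w | c * Z w <= y] = [set w | Z w <= y / c].
  by apply/seteqP; split => w /=; rewrite E.
by rewrite !S1 !S2.
Qed.

End WeakConvergence.

Lemma measurable_invr {R : realType} : measurable_fun setT (fun x : R => x^-1).
Proof.
have -> : [set: R] = `]-oo, 0[%classic `|` ([set 0] `|` `]0, +oo[%classic).
  apply/esym; rewrite -subTset => x _ /=; rewrite !in_itv/= andbT.
  by case: (ltgtP x 0) => [h|h|h]; [left|right; right|right; left].
apply/measurable_funU => //; first exact: measurableU.
split; last first.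
  apply/measurable_funU => //; split; first exact: measurable_fun_set1.
  exact: measurable_inv_pos.
apply: open_continuous_measurable_fun; first exact: interval_open.
move=> x; rewrite inE/= in_itv/= => x0.
by apply: inv_continuous; rewrite lt_eqF.
Qed.

(** * Tightness at infinity and at zero, and inversion *)

Section Tightness.
Context {d' : measure_display} {T' : measurableType d'} {R : realType}.
Variables (P' : probability T' R) (L : {RV P' >-> R}).

Lemma tight_pinfty (e : R) : 0 < e -> exists M, 0 < M /\ prob P' [set w | M < L w] <= e.
Proof.
move=> e0; have := cvg_ccdfy0 L; move=> /fine_cvgP[_ /cvgrPdist_le/(_ e e0) h].
have /filter_ex[M [hM M0]] := near_pinftyI h (near_pinfty_gt 0).
exists M; split=> //; move: hM; rewrite /= sub0r normrN ger0_norm ?fine_ge0//.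
by rewrite /ccdf /distribution /pushforward set_itvoy.
Qed.

(** The distribution function vanishes at 0 and is right-continuous there. *)
Lemma tight_zero (e : R) : prob P' [set w | L w <= 0] = 0 -> 0 < e ->
  exists r, 0 < r /\ prob P' [set w | L w <= r] <= e.
Proof.
move=> L0 e0; have := @cdf_right_continuous _ _ _ _ L 0.
have c0 : cdf L 0 = 0%:E.
  apply: etrans (congr1 EFin L0); rewrite probK; last by apply: measurable_ger.
  by rewrite /cdf /distribution /pushforward set_itvNyc.
rewrite c0 => /fine_cvgP[_ /cvgrPdist_le/(_ e e0) h].
have nr : \forall r \near (0 : R)^'+,
    `|0 - (fine \o cdf L) r| <= e /\ 0 < r.
  near=> r; split; first by near: r; exact: h.
  by near: r; exact: nbhs_right_gt.
have [r [hr r0]] := @filter_ex _ _ (at_right_proper_filter (0 : R)) _ nr.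
exists r; split=> //; move: hr; rewrite /= sub0r normrN ger0_norm ?fine_ge0//.
Unshelve. all: by end_near. Qed.

End Tightness.

Section LawCloseInverse.
Context {d d' : measure_display} {T : measurableType d} {T' : measurableType d'}
  {R : realType}.
Variables (P : probability T R) (P' : probability T' R).
Variables (A : R -> T -> R) (L : {RV P' >-> R}).
Hypotheses (mA : forall t, measurable_fun setT (A t))
  (L0 : prob P' [set w | L w <= 0] = 0) (AL : law_close P P' A L).

Lemma law_close_tight_pinfty (e : R) : 0 < e ->
  exists M, 0 < M /\ \forall t \near +oo, prob P [set w | M < A t w] <= e.
Proof.
move=> e0; have e20 : 0 < e / 2 by lra.
have [M [M0 hM]] := tight_pinfty L e20.
exists (M + 1); split; first by lra.
have MM : M < M + 1 by lra.
apply: filterS (AL MM e20) => t [_].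
have mL x : measurable [set w | L w <= x] by apply: measurable_ger.
have mAx x : measurable [set w | A t w <= x] by apply: measurable_ger.
have E1 : prob P' [set w | M < L w] = 1 - prob P' [set w | L w <= M].
  by apply: prob_gt.
have E2 : prob P [set w | M + 1 < A t w] = 1 - prob P [set w | A t w <= M + 1].
  by apply: prob_gt.
by move: hM; rewrite E1 E2; lra.
Qed.

Lemma law_close_tight_zero (e : R) : 0 < e ->
  exists r, 0 < r /\ \forall t \near +oo, prob P [set w | A t w <= r] <= e.
Proof.
move=> e0; have e20 : 0 < e / 2 by lra.
have [r [r0 hr]] := tight_zero L0 e20.
exists (r / 2); split; first by lra.
have rr : r / 2 < r by lra.
by apply: filterS (AL rr e20) => t [+ _]; lra.
Qed.

(** Inversion reverses order on the positive half-line only; values of [A t] at most 0 are paid for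
    by tightness at zero. *)
Lemma law_close_inv : law_close P P' (fun t w => (A t w)^-1) (fun w => (L w)^-1).
Proof.
move=> z z' e zz' e0; have e20 : 0 < e / 2 by lra.
have [r [r0 Hr]] := law_close_tight_zero e20.
have mL0 : measurable [set w | L w <= 0] by apply: measurable_ger.
have mLi x : measurable [set w | (L w)^-1 <= x].
  by apply: measurable_ger; apply: measurableT_comp => //; exact: measurable_invr.
have mAi t x : measurable [set w | (A t w)^-1 <= x].
  by apply: measurable_ger; apply: measurableT_comp => //; exact: measurable_invr.
have mLx x : measurable [set w | L w <= x] by apply: measurable_ger.
have mAx t x : measurable [set w | A t w <= x] by apply: measurable_ger.
have mLg x : measurable [set w | x < L w] by apply: measurable_gtr.
have mAg t x : measurable [set w | x < A t w] by apply: measurable_gtr.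
have hA0 t : prob P [set w | A t w <= 0] <= prob P [set w | A t w <= r].
  by apply: le_prob => // w /= /le_trans; apply; exact: ltW.
(* For [z' <= 0] the threshold [z] is negative and met only by nonpositive variables, of small
   probability for [A t] and of probability 0 for [L]. *)
have [z'0|z'0] := leP z' 0.
  have z0 : z < 0 by exact: lt_le_trans z'0.
  apply: filterS Hr => t h; split.
    apply: (@le_trans _ _ (prob P [set w | A t w <= 0])).
      apply: le_prob => // w /= Az; rewrite leNgt; apply/negP => Apos.
      have : 0 < (A t w)^-1 by rewrite invr_gt0.
      lra.
    have := hA0 t; have := prob_ge0 P' [set w | (L w)^-1 <= z']; lra.
  apply: (@le_trans _ _ (prob P' [set w | L w <= 0])).
    apply: le_prob => // w /= Lz; rewrite leNgt; apply/negP => Lpos.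
    have : 0 < (L w)^-1 by rewrite invr_gt0.
    lra.
  by rewrite L0 addr_ge0 ?prob_ge0// ltW.
(* [z] itself may be nonpositive; [z1] is a positive level strictly between [z] and [z'], so it can
   be inverted. *)
pose z1 := (Num.max 0 z + z') / 2.
have m0 : 0 <= Num.max 0 z by rewrite le_max lexx.
have mz : z <= Num.max 0 z by rewrite le_max lexx orbT.
have mz' : Num.max 0 z < z' by rewrite gt_max z'0.
have z10 : 0 < z1 by rewrite /z1; lra.
have zz1 : z < z1 by rewrite /z1; lra.
have z1z' : z1 < z' by rewrite /z1; lra.
have yy : z'^-1 < z1^-1 by rewrite ltf_pV2.
have inv_sub (x : R) : x^-1 <= z -> x <= 0 \/ z1^-1 < x.
  move=> xz; have [|x0] := leP x 0; [by left|right].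
  by rewrite invf_plt//; exact: le_lt_trans zz1.
have sub_inv (x : R) : z'^-1 < x -> x^-1 <= z'.
  move=> xz; have x0 : 0 < x by apply: lt_trans xz; rewrite invr_gt0.
  by rewrite invf_ple// ltW.
have EL x : prob P' [set w | x < L w] = 1 - prob P' [set w | L w <= x].
  by apply: prob_gt.
have EA t x : prob P [set w | x < A t w] = 1 - prob P [set w | A t w <= x].
  by apply: prob_gt.
apply: filterS (near_pinftyI Hr (AL yy e20)) => t [h [h1 h2]]; split.
  have l1 : prob P [set w | (A t w)^-1 <= z] <=
      prob P [set w | A t w <= 0] + prob P [set w | z1^-1 < A t w].
    by apply: le_probU => // w /= /inv_sub.
  have l2 : prob P' [set w | z'^-1 < L w] <= prob P' [set w | (L w)^-1 <= z'].
    by apply: le_prob => // w /= /sub_inv.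
  move: l1 l2; rewrite EL EA; have := hA0 t; lra.
have l1 : prob P' [set w | (L w)^-1 <= z] <=
    prob P' [set w | L w <= 0] + prob P' [set w | z1^-1 < L w].
  by apply: le_probU => // w /= /inv_sub.
have l2 : prob P [set w | z'^-1 < A t w] <= prob P [set w | (A t w)^-1 <= z'].
  by apply: le_prob => // w /= /sub_inv.
move: l1 l2; rewrite EL EA L0; lra.
Qed.

End LawCloseInverse.

Section RatioEstimate.
Context {R : realType}.

(** Uniform continuity of the ratio near [s1 = m A], [s2 = 2 A], made explicit: over a common
    denominator the error is at most [eta C / D]. *)
Lemma ratio_estimate (m r M delta : R) : 0 < m -> 0 < r -> 0 < M -> 0 < delta ->
  exists eta : R, 0 < eta /\ forall A s1 s2 : R, r < A -> A <= M ->
    `|s1 - m * A| < eta -> `|s2 - 2 * A| < eta ->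
    0 < s1 /\ `|A ^+ 2 * (s2 / s1 ^+ 2) - 2 / m ^+ 2 * A| < delta.
Proof.
move=> m0 r0 M0 delta0.
pose C : R := M * (m ^+ 2 * M + 2 * (2 * m * M + 1)).
have mr0 : 0 < m * r by rewrite mulr_gt0.
have mM0 : 0 < m * M by rewrite mulr_gt0.
have C0 : 0 < C.
  by rewrite /C; apply: mulr_gt0 => //; apply: addr_gt0; [rewrite mulr_gt0 ?exprn_gt0|nra].
pose D : R := m ^+ 2 * (m * r / 2) ^+ 2.
have D0 : 0 < D by rewrite /D mulr_gt0// exprn_gt0// divr_gt0.
(* The bound 1 gives [s1 + m A < 2 m M + 1], the second gives [s1 > m r / 2], and the third makes
   [eta C / D <= delta]. *)
pose eta : R := Num.min 1 (Num.min (m * r / 2) (delta * D / C)).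
have eta0 : 0 < eta by rewrite !lt_min ltr01/= !divr_gt0// mulr_gt0.
have e1 : eta <= 1 by rewrite /eta ge_min lexx.
have e2 : eta <= m * r / 2 by rewrite /eta !ge_min lexx orbT.
have e3 : eta * C <= delta * D by rewrite -ler_pdivlMr// /eta !ge_min lexx !orbT.
exists eta; split => // A s1 s2 rA AM h1 h2.
have A0 : 0 < A by exact: lt_trans rA.
have mrA : m * r < m * A by rewrite ltr_pM2l.
have mAM : m * A <= m * M by rewrite ler_pM2l.
move: (h1); rewrite ltr_norml => /andP[k1 k2].
have s1lb : m * r / 2 < s1 by lra.
have s10 : 0 < s1 by apply: lt_trans s1lb; rewrite divr_gt0.
split => //.
have -> : A ^+ 2 * (s2 / s1 ^+ 2) - 2 / m ^+ 2 * A =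
  A * (m ^+ 2 * A * (s2 - 2 * A) - 2 * ((s1 - m * A) * (s1 + m * A))) / (m ^+ 2 * s1 ^+ 2).
  by field; rewrite !gt_eqF.
rewrite normrM normrV ?unitfE; last by rewrite gt_eqF// mulr_gt0 ?exprn_gt0.
rewrite (gtr0_norm (_ : 0 < m ^+ 2 * s1 ^+ 2)); last by rewrite mulr_gt0 ?exprn_gt0.
rewrite ltr_pdivrMr; last by rewrite mulr_gt0 ?exprn_gt0.
apply: (@lt_le_trans _ _ (eta * C)); last first.
  apply: (le_trans e3); rewrite ler_pM2l// /D ler_pM2l ?exprn_gt0//.
  by rewrite ler_sqr ?nnegrE ltW// divr_gt0.
rewrite normrM (gtr0_norm A0) /C [ltRHS]mulrCA.
apply: (@le_lt_trans _ _ (M * `|m ^+ 2 * A * (s2 - 2 * A) - 2 * ((s1 - m * A) * (s1 + m * A))|)).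
  by apply: ler_wpM2r.
rewrite ltr_pM2l//; apply: (le_lt_trans (ler_normB _ _)).
have t1 : `|m ^+ 2 * A * (s2 - 2 * A)| <= m ^+ 2 * M * eta.
  have m20 : 0 < m ^+ 2 by rewrite exprn_gt0.
  have mA0 : 0 < m ^+ 2 * A by rewrite mulr_gt0.
  rewrite normrM (gtr0_norm mA0); apply: ler_pM => //; [exact: ltW| |exact: ltW].
  by apply: ler_wpM2l => //; exact: ltW.
have t2 : `|2 * ((s1 - m * A) * (s1 + m * A))| < 2 * (2 * m * M + 1) * eta.
  have p0 : 0 < s1 + m * A by lra.
  rewrite !normrM (gtr0_norm (ltr0n R 2)) (gtr0_norm p0) -mulrA ltr_pM2l//.
  rewrite mulrC; apply: (@le_lt_trans _ _ ((2 * m * M + 1) * `|s1 - m * A|)).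
    by apply: ler_wpM2r => //; lra.
  by rewrite ltr_pM2l//; lra.
lra.
Qed.

End RatioEstimate.

(** * Random times *)

Section RandomTime.
Context {d : measure_display} {T : measurableType d} {R : realType}.
Variables (P : probability T R) (X : nat -> {RV P >-> R}) (N : R -> {RV P >-> nat}).
Hypothesis XNindep : independent_systems P (sigma_family setT X)
  (sigma_family [set t : R | 0 <= t] N).

Lemma measurable_deviation q k (b c eta : R) :
  measurable [set w : T | eta <= `|power_sum X q k w / b - c|].
Proof.
apply: measurable_ler; apply: measurableT_comp => //; apply: measurable_funB => //.
by apply: measurable_funM => //; exact: measurable_power_sum.
Qed.

(* The event is measurable for the sigma-algebra generated by the variables
   alone, so redoing its measurability proof on that measurable space places
   it in [sigma_family]. *)
Lemma sigma_family_deviation q k (b c eta : R) :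
  sigma_family setT X [set w : T | eta <= `|power_sum X q k w / b - c|].
Proof.
pose G : set_system T := \bigcup_(i in setT) preimage_set_system setT (X i) measurable.
pose TG : measurableType _ := g_sigma_algebraType G.
have mX i : measurable_fun [set: TG] (X i : TG -> R).
  move=> _ B mB; rewrite setTI; apply: sub_sigma_algebra; exists i => //.
  by exists B => //; rewrite setTI.
have : measurable [set w : TG | eta <= `|power_sum X q k w / b - c|].
  apply: measurable_ler; apply: measurableT_comp => //; apply: measurable_funB => //.
  apply: measurable_funM => //; apply: measurable_sum => i.
  by apply: measurable_funX; exact: mX.
by [].
Qed.

Lemma sigma_family_time t n : 0 <= t ->
  sigma_family [set t : R | 0 <= t] N (N t @^-1` [set n]).
Proof.
move=> t0; apply: sub_sigma_algebra; exists t => //.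
by exists [set n] => //; rewrite setTI.
Qed.

(** Tightness confines [N t] to [k <= M t] up to probability [e / 2]; on that range the uniform
    bound passes to the random index. *)
Lemma random_time_weak_law q (b : R -> R) (c : R) :
  (forall M eta e : R, 0 < M -> 0 < eta -> 0 < e -> \forall t \near +oo,
    forall k : nat, k%:R <= M * t ->
    prob P [set w | eta <= `|power_sum X q k w / b t ^+ q - c * (k%:R / t)|] <= e) ->
  (forall e : R, 0 < e -> exists M, 0 < M /\
    \forall t \near +oo, prob P [set w | M < (N t w)%:R / t] <= e) ->
  forall eta e : R, 0 < eta -> 0 < e -> \forall t \near +oo,
    prob P [set w | eta <= `|power_sum X q (N t w) w / b t ^+ q -
                             c * ((N t w)%:R / t)|] <= e.
Proof.
move=> Hu Htight eta e eta0 e0; have e20 : 0 < e / 2 by lra.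
have [M [M0 HM]] := Htight _ e20.
have := near_pinftyI HM (near_pinftyI (Hu M eta (e / 2) M0 eta0 e20) (near_pinfty_gt 0)).
apply: filterS => t [h1 [h2 t0]].
pose B k := [set w | eta <= `|power_sum X q k w / b t ^+ q - c * (k%:R / t)|].
have mB k : measurable (B k) by exact: measurable_deviation.
(* [n < K] is then equivalent to [n <= M t]. *)
pose K := (Num.truncn (M * t)).+1.
have Mt0 : 0 <= M * t by rewrite mulr_ge0// ltW.
have h3 : prob P [set w | (N t w < K)%N /\ B (N t w) w] <= e / 2.
  apply: prob_random_index_lt => //; first exact: ltW.
    by move=> n; rewrite ltnS truncn_ge_nat// => nM; exact: h2.
  move=> n; apply: XNindep; first exact: sigma_family_deviation.
  by apply: sigma_family_time; exact: ltW.
have mNt : measurable_fun setT (fun w => (N t w)%:R / t : R).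
  by apply: (measurable_random_index (F := fun n _ => n%:R / t)).
have mNK : measurable [set w | (N t w < K)%N /\ B (N t w) w].
  have -> : [set w | (N t w < K)%N /\ B (N t w) w] =
      \bigcup_(n in [set n | (n < K)%N]) (N t @^-1` [set n] `&` B n).
    by apply/seteqP; split => w /=; [move=> [h ?]; exists (N t w)|move=> [n h [-> Bn]]].
  apply: bigcup_measurable => n _; apply: measurableI => //.
  by apply: measurable_funPTI.
apply: (@le_trans _ _ (e / 2 + e / 2)); last by lra.
apply: le_trans (lerD h1 h3); apply: le_probU => //.
- by apply: measurable_gtr.
- apply: measurable_ler; apply: measurableT_comp => //.
  apply: (measurable_random_index
    (F := fun n w => power_sum X q n w / b t ^+ q - c * (n%:R / t))) => n.
  apply: measurable_funB => //; apply: measurable_funM => //.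
  exact: measurable_power_sum.
- move=> w /= Bw; have [NM|] := leP ((N t w)%:R / t) M; [right|by left].
  by split=> //; rewrite ltnS truncn_ge_nat// -ler_pdivrMr.
Qed.

Lemma measurable_T_ n : measurable_fun setT (T_ X n).
Proof.
rewrite /T_; case: (0 < n)%N => //.
apply: measurable_funM; first exact: (measurable_power_sum X 2).
apply: (measurableT_comp measurable_invr); apply: measurable_funX.
by apply: measurable_sum => i; exact: measurable_funPT.
Qed.

End RandomTime.

(** * Convergence in law of the two normalized statistics *)

Theorem theorem4 (R : realType)
    (d : measure_display) (T : measurableType d) (P : probability T R)
    (d' : measure_display) (T' : measurableType d') (P' : probability T' R)
    (X : nat -> {RV P >-> R}) (N : R -> {RV P >-> nat}) (L : {RV P' >-> R})
    (l a : R -> R)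
    (Xpos : forall i, P [set w | 0 < X i w] = 1%E)
    (Xindep : mutually_independent X)
    (Xid : identically_distributed X)
    (Ncount : counting_process N)
    (XNindep : independent_systems P (sigma_family setT X)
                 (sigma_family [set t : R | 0 <= t] N))
    (Xpareto : pareto_type 2 (fun x => fine (cdf (X 0%N) x)) l)
    (mu2 : moment (X 0%N) 2 = +oo%E)
    (NL : D_averages N L)
    (al : normalizing l a) :
  let mu1 := fine (moment (X 0%N) 1) in
  cvg_in_distribution P (fun t w => ((N t w)%:R / a t) ^+ 2 * T_ X (N t w) w)
    P' (fun w => 2 / mu1 ^+ 2 * L w) /\
  cvg_in_distribution P (fun t w => (t / a t) ^+ 2 * T_ X (N t w) w)
    P' (fun w => 2 / mu1 ^+ 2 * (L w)^-1).
Proof.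
move=> mu1.
pose A t w : R := (N t w)%:R / t.
have mA t : measurable_fun setT (A t).
  by apply: (measurable_random_index (F := fun n _ => n%:R / t)).
have [Lpos NL'] := NL.
have AL : law_close P P' A L by exact: cvg_in_distribution_law_close.
have L0 : prob P' [set w | L w <= 0] = 0 by exact: prob_le0.
have X0pos := Xpos 0%N.
have rv := pareto_tail_rv2 Xpareto.
have mu10 : 0 < mu1 by exact: moment1_gt0.
have Atight e : 0 < e -> exists M, 0 < M /\
    \forall t \near +oo, prob P [set w | M < A t w] <= e.
  by exact: (law_close_tight_pinfty mA AL).
have Azero e : 0 < e -> exists r, 0 < r /\
    \forall t \near +oo, prob P [set w | A t w <= r] <= e.
  by exact: (law_close_tight_zero L0 AL).
have U1 eta e : 0 < eta -> 0 < e -> \forall t \near +oo,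
    prob P [set w | eta <= `|power_sum X 1 (N t w) w / t ^+ 1 - mu1 * A t w|] <= e.
  move=> eta0 e0; apply: (random_time_weak_law XNindep (b := id)) => // M eta' e' M0 eta'0 e'0.
  apply: uniform_weak_law => //.
  - exact: near_pinfty_gt.
  - move=> r r0; apply: filterS (near_pinftyI (tmoment1_cvg X0pos rv r0) (near_pinfty_gt 0)).
    move=> t [/andP[h1 h2] t0]; rewrite expr1 divff ?gt_eqF// mul1r ler_norml.
    by apply/andP; split; rewrite -/mu1 in h1 h2; lra.
  - by move=> r r0; exact: (tail_cvg0 X0pos rv).
  - move=> r r0; apply: filterS (near_pinftyI (tmoment2_small X0pos rv r0) (near_pinfty_gt 0)).
    move=> t [h1 t0]; rewrite addn1 expr2 invfM mulrA divff ?gt_eqF// mul1r.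
    by rewrite ler_pdivrMl// mulrC.
have U2 eta e : 0 < eta -> 0 < e -> \forall t \near +oo,
    prob P [set w | eta <= `|power_sum X 2 (N t w) w / a t ^+ 2 - 2 * A t w|] <= e.
  move=> eta0 e0; apply: (random_time_weak_law XNindep) => // M eta' e' M0 eta'0 e'0.
  apply: uniform_weak_law => //.
  - exact: (near_normalizing al (near_pinfty_gt 0)).
  - move=> r r0; apply: filterS (normalizing_tmoment2 X0pos Xpareto mu2 al r0).
    by move=> t [].
  - by move=> r r0; exact: (normalizing_tail X0pos Xpareto mu2 al).
  - by move=> r r0; exact: (normalizing_tmoment4 X0pos Xpareto mu2 al).
have apos : \forall t \near +oo, 0 < a t by exact: (near_normalizing al (near_pinfty_gt 0)).
(* The powers of [t] cancel: off the default cases this is statistic (a), in terms of the quantities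
   controlled by [U1] and [U2]. *)
pose V t w := A t w ^+ 2 * ((power_sum X 2 (N t w) w / a t ^+ 2) /
                            (power_sum X 1 (N t w) w / t ^+ 1) ^+ 2).
have mS q (c : R) t : measurable_fun setT (fun w => power_sum X q (N t w) w / c).
  apply: (measurable_random_index (F := fun n w => power_sum X q n w / c)) => n.
  by apply: measurable_funM => //; exact: measurable_power_sum.
have mYa t : measurable_fun setT (fun w => ((N t w)%:R / a t) ^+ 2 * T_ X (N t w) w).
  apply: (measurable_random_index (F := fun n w => (n%:R / a t) ^+ 2 * T_ X n w)) => n.
  by apply: measurable_funM => //; exact: measurable_T_.
have mYb t : measurable_fun setT (fun w => (t / a t) ^+ 2 * T_ X (N t w) w).
  apply: (measurable_random_index (F := fun n w => (t / a t) ^+ 2 * T_ X n w)) => n.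
  by apply: measurable_funM => //; exact: measurable_T_.
have mAi t : measurable_fun setT (fun w => (A t w)^-1).
  by apply: measurableT_comp => //; exact: measurable_invr.
(* One exceptional set serves both statistics: it collects large [A], small [A] and the two weak-law
   deviations, [e / 4] each. *)
have key delta e : 0 < delta -> 0 < e -> \forall t \near +oo, exists E : set T,
    [/\ measurable E, prob P E <= e & forall w, ~ E w ->
      `|((N t w)%:R / a t) ^+ 2 * T_ X (N t w) w - 2 / mu1 ^+ 2 * A t w| < delta /\
      `|(t / a t) ^+ 2 * T_ X (N t w) w - 2 / mu1 ^+ 2 * (A t w)^-1| < delta].
  move=> delta0 e0; have e40 : 0 < e / 4 by lra.
  have [M [M0 HM]] := Atight _ e40.
  have [r [r0 Hr]] := Azero _ e40.
  (* The error in (b) is the error in (a) divided by [A^2 > r^2]. *)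
  pose delta' := Num.min delta (delta * r ^+ 2).
  have r20 : 0 < r ^+ 2 by rewrite exprn_gt0.
  have delta'0 : 0 < delta' by rewrite lt_min delta0 mulr_gt0.
  have [eta [eta0 Heta]] := ratio_estimate mu10 r0 M0 delta'0.
  have := near_pinftyI (near_pinftyI HM Hr) (near_pinftyI
    (near_pinftyI (U1 _ _ eta0 e40) (U2 _ _ eta0 e40)) (near_pinftyI apos (near_pinfty_gt 0))).
  apply: filterS => t [[hM hr] [[h1 h2] [at0 t0]]].
  set E1 := [set w | M < A t w] in hM *; set E2 := [set w | A t w <= r] in hr *.
  set E3 := [set w | eta <= _] in h1 *; set E4 := [set w | eta <= _] in h2 *.
  have mE1 : measurable E1 by apply: measurable_gtr.
  have mE2 : measurable E2 by apply: measurable_ger.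
  have mE3 : measurable E3.
    apply: measurable_ler; apply: measurableT_comp => //; apply: measurable_funB => //.
    exact: measurable_funM.
  have mE4 : measurable E4.
    apply: measurable_ler; apply: measurableT_comp => //; apply: measurable_funB => //.
    exact: measurable_funM.
  have mE12 := measurableU _ _ mE1 mE2; have mE34 := measurableU _ _ mE3 mE4.
  exists ((E1 `|` E2) `|` (E3 `|` E4)); split; first exact: measurableU.
    have := probU P mE12 mE34; have := probU P mE1 mE2; have := probU P mE3 mE4.
    lra.
  move=> w /not_orP[/not_orP[/negP + /negP +] /not_orP[/negP + /negP +]].
  rewrite -leNgt -!ltNge => AM rA k1 k2.
  have [s10 h] := Heta _ _ _ rA AM k1 k2.
  have A0 : 0 < A t w by exact: lt_trans rA.
  (* [A t w > r > 0] rules out the default value 0 of [T_]. *)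
  have Npos : (0 < N t w)%N.
    by rewrite -(ltr0n R); move: A0; rewrite /A pmulr_lgt0// invr_gt0.
  have S10 : 0 < power_sum X 1 (N t w) w by move: s10; rewrite pmulr_lgt0// invr_gt0 expr1.
  have TE : T_ X (N t w) w = power_sum X 2 (N t w) w / power_sum X 1 (N t w) w ^+ 2.
    have -> : power_sum X 1 (N t w) w = \sum_(i < N t w) X i w.
      by apply: eq_bigr => i _; rewrite expr1.
    by rewrite /T_ Npos.
  have Ea : ((N t w)%:R / a t) ^+ 2 * T_ X (N t w) w = V t w.
    by rewrite TE /V /A; field; rewrite !gt_eqF.
  have Eb : (t / a t) ^+ 2 * T_ X (N t w) w - 2 / mu1 ^+ 2 * (A t w)^-1 =
      (V t w - 2 / mu1 ^+ 2 * A t w) / A t w ^+ 2.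
    by rewrite TE /V /A; field; rewrite !gt_eqF// ltr0n.
  rewrite Ea Eb; split; first by apply: lt_le_trans h _; rewrite /delta' ge_min lexx.
  have A20 : 0 < A t w ^+ 2 by rewrite exprn_gt0.
  rewrite normrM normfV (gtr0_norm A20) ltr_pdivrMr//.
  apply: lt_le_trans h _; apply: (@le_trans _ _ (delta * r ^+ 2)).
    by rewrite /delta' ge_min lexx orbT.
  by rewrite ler_pM2l// ler_sqr ?nnegrE// ltW.
have mu1c : 0 < 2 / mu1 ^+ 2 by rewrite divr_gt0// exprn_gt0.
split; apply: law_close_cvg => //.
- by apply: measurable_funM => //; exact: measurable_funPT.
- apply: (law_close_perturb (Y' := fun t w => 2 / mu1 ^+ 2 * A t w)) => //.
  + by move=> t; exact: measurable_funM.
  + move=> eta e eta0 e0; apply: filterS (key _ _ eta0 e0) => t [E [mE PE h]].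
    apply: le_trans PE; apply: le_prob => //.
      apply: measurable_ler; apply: measurableT_comp => //; apply: measurable_funB => //.
      exact: measurable_funM.
    by move=> w /= hw; apply/not_notP => /h[+ _]; rewrite ltNge hw.
  + exact: law_closeZ.
- apply: measurable_funM => //; apply: measurableT_comp; first exact: measurable_invr.
  exact: measurable_funPT.
- apply: (law_close_perturb (Y' := fun t w => 2 / mu1 ^+ 2 * (A t w)^-1)) => //.
  + by move=> t; exact: measurable_funM.
  + move=> eta e eta0 e0; apply: filterS (key _ _ eta0 e0) => t [E [mE PE h]].
    apply: le_trans PE; apply: le_prob => //.
      apply: measurable_ler; apply: measurableT_comp => //; apply: measurable_funB => //.
      exact: measurable_funM.
    by move=> w /= hw; apply/not_notP => /h[_ +]; rewrite ltNge hw.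
  + apply: law_closeZ => //; exact: (law_close_inv mA L0 AL).
Qed.
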